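(* Let $V$ be a set of $n=2^N$ nodes containing a distinguished server node $u$, let $\mathcal{N}_1$ be any initial $N$-dimensional hypercube on $V$, and let $\sigma=(\sigma_1,\dots,\sigma_m)$ be any sequence (fixed in advance) of requests of the form $\sigma_i=(u,v_i)$ with $v_i\neq u$. If the network is maintained by the randomized algorithm DyHypes-S described in the context, then $$\mathbb{E}\Big[\sum_{i=1}^{m} d(\mathcal{N}_i,\sigma_i)\Big]\ \le\ WS(\sigma)+m ,$$ where $\mathcal{N}_i$ is the (random) hypercube just before serving $\sigma_i$.
   Context: Hypercube networks: $V$ is a set of $n=2^N$ nodes. An $N$-dimensional hypercube on $V$ is a bijection $\mathrm{Coord}:V\to\{0,1\}^N$; two nodes are linked iff their coordinates differ in exactly one bit. The routing distance $d(\mathcal{N}_t,(u,v))$ is the shortest-path distance between $u$ and $v$. For $0\le d\le N$, the level-$d$ subtree $s^x_d$ of $x$ is the set of nodes whose coordinates agree with $\mathrm{Coord}(x)$ in the first $d$ bits; for $1\le d\le N$ the level-$d$ complementary subtree is $\sim s^x_d=s^x_{d-1}\setminus s^x_d$. $L_{lca}(u,v)$ is the length of the longest common prefix of the coordinates of $u,v$; the tree distance is $d_{Tree}(\mathcal{N}_t,(u,v))=N-L_{lca}(u,v)$. Algorithm DyHypes-S (single-server model, every request involves the server $u$): upon request $(u,v)$ at time $t$ in hypercube $\mathcal{N}_t$, route from $u$ to $v$ and let $\alpha=L_{lca}(u,v)$. Then, sequentially for $d=\alpha+2,\alpha+3,\dots,N$, choose a node $r$ uniformly at random (independently of all other choices)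 from the current $\sim s^u_d$ and swap the coordinates of $v$ and $r$. (Thus after step $d$, $v\in\sim s^u_d$, and at the end $v$ and $u$ differ only in the last bit.) The result is $\mathcal{N}_{t+1}$. Communication graph: for times $t'\le t$, the simple undirected graph on $V$ with an edge $\{a,b\}$ for each request $(a,b)$ made at a time in $[t',t)$; $\mathcal{G}_x(t',t)$ is the connected component containing $x$. Working set number $T_t(u,v)$ at time $t$: (i) if $u$ and $v$ communicated before time $t$, with last such time $t'$, it is the number of nodes of $\mathcal{G}_u(t',t)$; (ii) otherwise, with $V_u,V_v$ the vertex sets of $\mathcal{G}_u(0,t)$, $\mathcal{G}_v(0,t)$: if $v\in V_u$ it is $|V_u|$; if $v\notin V_u$ it is $\max(2^{d},|V_u|+|V_v|)$ with $d=d_{Tree}(\mathcal{N}_t,(u,v))$. Working set bound: $WS(\sigma)=\sum_{i=1}^{m}\lceil \log_2 T_i(\sigma_i)\rceil$, with $T_i(\sigma_i)$ the working set number of $\sigma_i$ at time $i$ w.r.t. $\mathcal{N}_i$. *)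

(* Defs.v *)
(* Expectations are exact rational sums over the finite
   probability tree generated by the algorithm's uniform random choices. *)
From HB Require Import structures.
From mathcomp Require Import all_boot all_order all_algebra.
Set Implicit Arguments. Unset Strict Implicit. Unset Printing Implicit Defensive.
Import Order.TTheory GRing.Theory Num.Theory.

Section Hypercube.
Variables (N : nat) (V : finType).

(* A (candidate) hypercube: the coordinate map Coord : V -> {0,1}^N. *)
Definition state := {ffun V -> N.-tuple bool}.

Definition hamming (x y : seq bool) : nat := count (fun p => p.1 != p.2) (zip x y).

Definition adj (c : state) : rel V := fun a b => hamming (c a) (c b) == 1%N.

Fixpoint ball (c : state) (k : nat) (a : V) : {set V} :=
  match k with
  | 0 => [set a]
  | k'.+1 => ball c k' a :|: [set y | [exists x in ball c k' a, adj c x y]]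
  end.

(* shortest-path (routing) distance d(N,(a,b)): least k with b within k links
   of a (simple paths have < #|V| links). *)
Definition dist (c : state) (a b : V) : nat :=
  find (fun k => b \in ball c k a) (iota 0 #|V|).

Definition lcp (x y : seq bool) : nat := find (fun p => p.1 != p.2) (zip x y).

Definition subtree (c : state) (x : V) (d : nat) : {set V} :=
  [set y | take d (c y) == take d (c x)].
Definition csubtree (c : state) (x : V) (d : nat) : {set V} :=
  subtree c x d.-1 :\: subtree c x d.

Definition swapc (c : state) (v r : V) : state :=
  [ffun x => if x == v then c r else if x == r then c v else c x].

(* Expectation of F(final state) after the sequential random swaps of
   DyHypes-S for levels ds: at each level d, r is uniform in the current
   ~s^u_d and the coordinates of v and r are swapped. *)
Fixpoint swapsE (u v : V) (ds : seq nat) (F : state -> rat) (c : state) : rat :=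
  match ds with
  | [::] => F c
  | d :: ds' =>
      (#|csubtree c u d|%:R^-1 *
       \sum_(r in csubtree c u d) swapsE u v ds' F (swapc c v r))%R
  end.

Definition stepE (u v : V) (F : state -> rat) (c : state) : rat :=
  let alpha := lcp (c u) (c v) in
  swapsE u v (iota alpha.+2 (N - alpha.+1)) F c.

(* E[ sum_{i = t}^{t + size s - 1} g i N_i ] when the requests s are served
   from time t onward, starting from hypercube c (N_t = c). *)
Fixpoint runE (s : seq (V * V)) (g : nat -> state -> rat) (t : nat) (c : state)
  : rat :=
  match s with
  | [::] => 0%R
  | p :: s' => (g t c + stepE p.1 p.2 (runE s' g t.+1) c)%R
  end.

(* request at time j (1-based) *)
Definition req (s : seq (V * V)) (dflt : V * V) (j : nat) : V * V := nth dflt s j.-1.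

Definition same_pair (p : V * V) (a b : V) : bool :=
  (p == (a, b)) || (p == (b, a)).

Definition cedge (s : seq (V * V)) (t' t : nat) : rel V := fun a b =>
  [exists j : 'I_(size s), (t' <= j.+1 < t) && same_pair (nth (a, b) s j) a b].

Definition comp (s : seq (V * V)) (t' t : nat) (x : V) : {set V} :=
  [set y | connect (cedge s t' t) x y].

Definition comm_before (s : seq (V * V)) (t : nat) (a b : V) : bool :=
  [exists j : 'I_(size s), (j.+1 < t) && same_pair (nth (a, b) s j) a b].

Definition last_comm (s : seq (V * V)) (t : nat) (a b : V) : nat :=
  \max_(j < size s | (j.+1 < t) && same_pair (nth (a, b) s j) a b) j.+1.

Definition WSnum (s : seq (V * V)) (c : state) (t : nat) (u v : V) : nat :=
  if comm_before s t u v then #|comp s (last_comm s t u v) t u|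
  else if v \in comp s 0 t u then #|comp s 0 t u|
  else maxn (2 ^ (N - lcp (c u) (c v))) (#|comp s 0 t u| + #|comp s 0 t v|).

Definition expected_cost (x0 : V) (s : seq (V * V)) (c0 : state) : rat :=
  runE s (fun t c => (dist c (req s (x0, x0) t).1 (req s (x0, x0) t).2)%:R%R) 1 c0.

(* E[ WS(sigma) ] = E[ sum_i ceil(log2 T_i(sigma_i)) ], T_i w.r.t. the random N_i;
   up_log 2 n is the least e with n <= 2^e, i.e. ceil(log2 n) for n >= 1. *)
Definition expected_WS (x0 : V) (s : seq (V * V)) (c0 : state) : rat :=
  runE s (fun t c =>
    (up_log 2 (WSnum s c t (req s (x0, x0) t).1 (req s (x0, x0) t).2))%:R%R) 1 c0.
End Hypercube.

(* Main.v *)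
(** The expected cost of a single request may exceed its own working set term,
    so the proof is amortized.

    Let the height of a node be [N] minus the length of the prefix it shares
    with the server; serving [v] costs at most its height, and one less unless
    [v] is the antipodal node of its level.  Nodes are kept in most-recently-used
    order.  If [v] has rank [j] and has been requested before, then the working
    set contains the nodes of rank at most [j] and the server, which gives
    [ceil(log2 T) >= trunc_log 2 j + 1].  If [v] is new, then
    [ceil(log2 T) >= height v].

    A node of height [l] with [H = 2^(l-1)] moves up with probability [1/H] while
    the levels above it are swapped.  For a node that will be requested next when
    its rank is [J], and whose rank will grow [s] more times until then, the
    potential is the monotone lower envelope [env J s] of a quadratic in
    [(s, H)] that is a martingale for this random walk.  A second term prepays
    for the events that [v] lands on the antipodal node of a level.  Only nodes
    of rank above [j] and height below that of [v] can increase the expected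
    potential.  There are few of them, because height never exceeds rank, and
    their ranks are distinct.  This reduces the amortized inequality to a
    statement about the pair [(j, h)] of rank and height, checked by
    integer arithmetic for small [j] and, near the critical heights, for one
    dyadic block that controls all large [j] by scaling; the remaining pairs
    have slack. *)
Require Import Defs.
From HB Require Import structures.
From Stdlib Require Import ZArith.
From mathcomp Require Import all_boot all_order all_algebra all_fingroup.
From mathcomp Require Import zify ssrZ ring lra.
Set Implicit Arguments. Unset Strict Implicit. Unset Printing Implicit Defensive.
Import Order.TTheory GRing.Theory Num.Theory.

(** * Levels of the server *)
Section Prefixes.
Implicit Types x y z : seq bool.

Lemma lcp_cons b x b' y : lcp (b :: x) (b' :: y) = if b == b' then (lcp x y).+1 else 0%N.
Proof. by rewrite /lcp /=; case: eqP. Qed.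

Lemma hamming_cons b x b' y : hamming (b :: x) (b' :: y) = ((b != b') + hamming x y)%N.
Proof. by []. Qed.

Lemma lcp_le x y : (lcp x y <= size x)%N.
Proof.
apply: leq_trans (find_size _ _) _; rewrite size_zip; exact: geq_minl.
Qed.

Lemma hamming_lcp x y : size x = size y -> (hamming x y + lcp x y <= size x)%N.
Proof.
elim: x y => [|b x IH] [|b' y] //= [/IH].
by rewrite lcp_cons hamming_cons; case: eqP => _ /=; lia.
Qed.

Lemma take_lcp x y d : size x = size y -> (d <= size x)%N ->
  (take d x == take d y) = (d <= lcp x y)%N.
Proof.
elim: x y d => [|b x IH] [|b' y] [|d] //= [/IH{}IH] /IH{}IH.
by rewrite lcp_cons eqseq_cons; case: eqP => //= _.
Qed.

Lemma lcp_self x : lcp x x = size x.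
Proof. by elim: x => //= b x IH; rewrite lcp_cons eqxx IH. Qed.

Lemma lcp_full x y : size x = size y -> lcp x y = size x -> x = y.
Proof.
elim: x y => [|b x IH] [|b' y] //= [sz]; rewrite lcp_cons.
by case: eqP => // -> [/IH ->].
Qed.

(** Maximal Hamming distance forces every bit after the common prefix with [a] to be flipped, so the
    length of that prefix determines the string. *)
Lemma hamming_full_uniq a x y : size x = size a -> size y = size a ->
  lcp a x = lcp a y -> (hamming a x + lcp a x = size a)%N ->
  (hamming a y + lcp a y = size a)%N -> x = y.
Proof.
elim: a x y => [|c a IH] [|b x] [|b' y] //= [szx] [szy].
rewrite !lcp_cons !hamming_cons; case: eqP => [<-|ne]; case: eqP => [<-|ne'] //= E.
  by move=> h1 h2; congr cons; apply: IH; lia.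
move=> h1 h2.
have bb : b = b' by move: c b b' ne ne' => [] [] [].
rewrite bb; congr cons.
have neg z : size z = size a -> hamming a z = size a -> z = map negb a.
  elim: a z {IH szx szy h1 h2} => [|d a IH2] [|e z] //= [sz]; rewrite hamming_cons => H.
  have hle : (hamming a z <= size a)%N.
    by have := hamming_lcp (esym sz); lia.
  have de : d != e by move: H; case: eqP => //=; lia.
  move: H; rewrite de => H; rewrite -(IH2 z) //; last by lia.
  by move: d e de {H} => [] [].
have -> := neg x szx; last by lia.
by have -> := neg y szy; last by lia.
Qed.
End Prefixes.

Section Levels.
Variables (N : nat) (a : N.-tuple bool).
Implicit Types t : N.-tuple bool.

Definition height t : nat := N - lcp a t.
(** Equivalently, the last [height t] bits of [a] are all complemented. Only at such a place can the
    routing cost reach the height. *)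
Definition antipodal t : bool := hamming a t == height t.

Lemma lcp_tuple t : (lcp a t <= N)%N.
Proof. by have := lcp_le a t; rewrite size_tuple. Qed.

Lemma hamming_le_height t : (hamming a t <= height t)%N.
Proof.
have := @hamming_lcp a t; rewrite !size_tuple /height => /(_ erefl).
by have := lcp_tuple t; lia.
Qed.

Lemma hamming_height t : (hamming a t + ~~ antipodal t <= height t)%N.
Proof.
have := hamming_le_height t; rewrite /antipodal.
by case: eqP => [->|/eqP ne] /=; lia.
Qed.

Lemma height_le t : (height t <= N)%N.
Proof. exact: leq_subr. Qed.

Lemma height0 t : (height t == 0%N) = (t == a).
Proof.
apply/idP/eqP => [|->]; last by rewrite /height lcp_self size_tuple subnn.
rewrite /height => h; apply/esym/val_inj => /=; apply: lcp_full; rewrite !size_tuple //.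
by have := lcp_tuple t; lia.
Qed.

Lemma antipodal_inj t t' : height t = height t' -> antipodal t -> antipodal t' -> t = t'.
Proof.
move=> ht /eqP bt /eqP bt'; apply: val_inj => /=.
have := lcp_tuple t; have := lcp_tuple t'; move: ht bt bt'; rewrite /height => ht bt bt' l1 l2.
by apply: (@hamming_full_uniq a); rewrite ?size_tuple //; lia.
Qed.

Lemma card_take d : (d <= N)%N -> #|[set t : N.-tuple bool | take d t == take d a]| = (2 ^ (N - d))%N.
Proof.
move=> dN.
pose f (w : (N - d).-tuple bool) : N.-tuple bool := insubd a (take d a ++ w).
have fE w : f w = take d a ++ w :> seq bool.
  by rewrite /f val_insubd size_cat size_takel !size_tuple // subnKC // eqxx.
have finj : injective f.
  move=> w w' /(congr1 val) /=; rewrite !fE => /eqP.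
  by rewrite eqseq_cat // eqxx /= => /eqP /val_inj.
have -> : [set t : N.-tuple bool | take d t == take d a] = f @: [set: (N - d).-tuple bool].
  apply/setP => t; rewrite inE; apply/eqP/imsetP => [E|[w _ ->]].
    have sz : size (drop d t) == (N - d)%N by rewrite size_drop size_tuple.
    exists (Tuple sz) => //; apply: val_inj; rewrite /= fE /= -E cat_take_drop //.
  by rewrite fE take_size_cat // size_takel ?size_tuple.
by rewrite card_imset // cardsT card_tuple card_bool.
Qed.

Lemma height_lt t k : (k <= N)%N -> (height t <= k)%N = (take (N - k) t == take (N - k) a).
Proof.
move=> kN; rewrite eq_sym take_lcp ?size_tuple //; last by lia.
by have := lcp_tuple t; rewrite /height; lia.
Qed.

Lemma card_height_le k : (k <= N)%N -> #|[set t | (height t <= k)%N]| = (2 ^ k)%N.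
Proof.
move=> kN; rewrite -[in RHS](_ : N - (N - k) = k)%N; last by lia.
rewrite -card_take; last by lia.
by apply: eq_card => t; rewrite !inE height_lt.
Qed.

Lemma card_height k : (k < N)%N -> #|[set t | height t == k.+1]| = (2 ^ k)%N.
Proof.
move=> kN.
have := card_height_le kN; rewrite expnS mul2n -addnn.
rewrite -(card_height_le (ltnW kN)).
rewrite -(cardsID [set t | (height t <= k)%N] [set t | (height t <= k.+1)%N]).
have -> : [set t | (height t <= k.+1)%N] :&: [set t | (height t <= k)%N] = [set t | (height t <= k)%N].
  by apply/setP => t; rewrite !inE; apply/andP/idP => [[]|h] //; split => //; apply: leqW.
move=> /addnI <-; apply: eq_card => t; rewrite !inE; lia.
Qed.

(** Translates the sets from which the algorithm draws, indexed by prefix length, into height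
    classes. *)
Lemma height_csub t d : (0 < d <= N)%N ->
  (take d.-1 t == take d.-1 a) && (take d t != take d a) = (height t == (N - d).+1).
Proof.
move=> /andP[d0 dN]; rewrite ![_ == take _ a]eq_sym !take_lcp ?size_tuple //; last by lia.
by have := lcp_tuple t; rewrite /height; lia.
Qed.
End Levels.

(** * Expectation over the random swaps *)
(** Resetting in [y] the first bit where it differs from [x] gives [z], the last node but one on a
    path from [x] to [y]. *)
Lemma hamming_flip (x y : seq bool) : size x = size y -> (0 < hamming x y)%N ->
  exists z, [/\ size z = size x, (hamming x z).+1 = hamming x y & hamming z y = 1%N].
Proof.
have h0 (w : seq bool) : hamming w w = 0%N by elim: w => //= b w; rewrite hamming_cons eqxx.
elim: x y => [|b x IH] [|b' y] //= [sz]; rewrite hamming_cons.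
case: (b =P b') => [->|ne] /= => [/(IH y sz)[z [sz' h1 h2]]|_].
  by exists (b' :: z); split; rewrite /= ?sz' // hamming_cons eqxx.
exists (b :: y); split; rewrite /= ?sz // hamming_cons ?eqxx ?h0 ?add0n //.
by case: eqP.
Qed.

(** * Routing distance against Hamming distance *)

Section Distance.
Variables (N : nat) (V : finType) (c : state N V).
Hypotheses (cardV : #|V| = (2 ^ N)%N) (injc : injective c).

Lemma coord_bij : bijective c.
Proof. by apply: inj_card_bij => //; rewrite card_tuple card_bool cardV. Qed.

Lemma hamming0_eq (x y : N.-tuple bool) : hamming x y = 0%N -> x = y.
Proof.
move=> h; apply: val_inj => /=; move: h.
have : size x = size y by rewrite !size_tuple.
elim: (val x) (val y) => [|b s IH] [|b' s'] //= [sz]; rewrite hamming_cons.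
by case: eqP => // -> /=; rewrite add0n => /(IH _ sz) ->.
Qed.

Lemma mem_ball k a x : (hamming (c a) (c x) <= k)%N -> x \in ball c k a.
Proof.
elim: k x => [|k IH] x /=.
  by rewrite leqn0 => /eqP /hamming0_eq /injc <-; rewrite inE.
move=> h; rewrite inE; case: (leqP (hamming (c a) (c x)) k) => [/IH -> //|lt].
have hE : hamming (c a) (c x) = k.+1 by lia.
have [||z [sz h1 h2]] := @hamming_flip (c a) (c x); rewrite ?size_tuple ?hE //.
have szN : size z == N by rewrite sz size_tuple.
have [g _ gK] := coord_bij.
apply/orP; right; rewrite inE; apply/existsP; exists (g (Tuple szN)).
by rewrite IH ?gK /=; [rewrite /adj gK h2 | lia].
Qed.

Lemma dist_le_hamming a b : (dist c a b <= hamming (c a) (c b))%N.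
Proof.
rewrite /dist leqNgt; apply/negP => lt.
have := before_find 0%N lt.
have lts : (hamming (c a) (c b) < #|V|)%N.
  by have := leq_trans lt (find_size _ _); rewrite size_iota.
by rewrite nth_iota // add0n mem_ball.
Qed.
End Distance.

(** * Expected potential after the swaps of one request *)

Section Swaps.
Variables (N : nat) (V : finType) (u : V) (a : N.-tuple bool).
Hypothesis cardV : #|V| = (2 ^ N)%N.
Local Open Scope ring_scope.
Implicit Types (c : state N V) (x v r : V).

Definition level c k : {set V} := [set x | height a (c x) == k].

Lemma csubtree_level c d : c u = a -> (0 < d <= N)%N -> csubtree c u d = level c (N - d).+1.
Proof.
move=> cu dN; apply/setP => x; rewrite !inE -height_csub // cu andbC.
by [].
Qed.

Lemma card_level c k : injective c -> (k < N)%N -> #|level c k.+1| = (2 ^ k)%N.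
Proof.
move=> inj kN; rewrite -(card_height a kN) -[LHS](card_imset _ inj).
apply: eq_card => t; rewrite inE; apply/imsetP/idP => [[x]|h].
  by rewrite inE => h ->.
have [g _ gK] := coord_bij cardV inj.
by exists (g t); rewrite ?inE gK.
Qed.

Lemma swapc_inj c v r : injective c -> injective (swapc c v r).
Proof.
have E x : swapc c v r x = c (tperm v r x).
  by rewrite ffunE; case: tpermP => [->|->|/eqP/negbTE-> /eqP/negbTE->]; rewrite ?eqxx //; case: eqP => // ->.
by move=> inj x y; rewrite !E => /inj /perm_inj.
Qed.

Lemma swapc_l c v r : swapc c v r v = c r. Proof. by rewrite ffunE eqxx. Qed.
Lemma swapc_r c v r : swapc c v r r = c v.
Proof. by rewrite ffunE eqxx; case: eqP => // ->. Qed.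
Lemma swapc_o c v r x : x != v -> x != r -> swapc c v r x = c x.
Proof. by rewrite ffunE => /negbTE -> /negbTE ->. Qed.

(** A node other than [v] rises at most once: it then occupies the former place of [v], above all
    levels still to be swapped. *)
Record after v c c' : Prop := After {
  after_inj : injective c';
  after_u : c' u = a;
  after_v : height a (c' v) = 1%N;
  after_x : forall x, x != v ->
    (height a (c' x) <= height a (c x) + (height a (c x) < height a (c v)))%N }.

Variables (ps : V -> nat -> rat) (om : V -> nat -> rat) (e : nat -> rat).
Hypothesis om_ge0 : forall x l, 0 <= om x l.
Hypothesis e_ge0 : forall l, 0 <= e l.
(** The node that takes over the place of [v] at height [k.+2] is uniform among [2 ^ k] nodes, so
    its expected charge on an antipodal place is at most [e k.+2]. *)
Hypothesis om_avg : forall k (B : {set V}), #|B| = (2 ^ k)%N ->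
  \sum_(x in B) om x k.+2 <= 2 ^+ k * e k.+2.

Definition pot x (t : N.-tuple bool) : rat :=
  ps x (height a t) + (if (5 <= height a t)%N && antipodal a t then om x (height a t) else 0).

(** Caps the expected final potential when [v] is at height [k.+1]. The third summand is the
    expected rise of the displaced nodes, each uniform among the [2 ^ l.-1] of its level. The fourth
    pays for the node inheriting the present place of [v], the last for [v] hitting the antipodal
    place of a lower level [l], of probability [1 / 2 ^ l.-1]. *)
Definition bound v k c : rat :=
  \sum_(x | x != v) pot x (c x) + ps v 1
  + \sum_(1 <= l < k.+1) (2 ^+ l.-1)^-1 * \sum_(x in level c l) (ps x l.+1 - ps x l)
  + (if (5 <= k.+1)%N && antipodal a (c v) then e k.+1 else 0)
  + \sum_(1 <= l < k.+1 | (5 <= l)%N) e l / 2 ^+ l.-1.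

Lemma iota_levels k : (k < N)%N -> iota (N - k.+1).+1 k.+1 = (N - k.+1).+1 :: iota (N - k).+1 k.
Proof. by move=> kN /=; congr (_ :: iota _ _); lia. Qed.

Lemma avg_antipodal k c : injective c -> (k < N)%N ->
  \sum_(r in level c k.+1) (if (5 <= k.+1)%N && antipodal a (c r) then e k.+1 else 0)
   <= if (5 <= k.+1)%N then e k.+1 else 0.
Proof.
move=> inj kN; case: (leqP 5 k.+1) => h5 /=; last by rewrite big1_eq.
rewrite -big_mkcondr /=.
have [/existsP[r0 /andP[r0l r0b]]|/existsPn none] := boolP [exists r, (r \in level c k.+1) && antipodal a (c r)].
  rewrite (big_pred1 r0) // => r /=; apply/andP/eqP => [[rl rb]|-> //].
  apply: inj; apply: (antipodal_inj (a := a)) => //.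
  by move: rl r0l; rewrite !inE => /eqP -> /eqP ->.
by rewrite big_pred0 // => r; apply/negbTE/none.
Qed.

(** Induction on the height of [v], conditioning on the first swap. Averaging over the displaced [r]
    turns its own rise, and the chance that it stood on the antipodal place, into the summands of
    [bound] for the top level. *)
Lemma swapsE_bound v (F G : state N V -> rat) k c :
  u != v -> (k < N)%N -> c u = a -> injective c -> height a (c v) = k.+1 ->
  (forall c', after v c c' -> F c' <= G c' + \sum_x pot x (c' x)) ->
  swapsE u v (iota (N - k).+1 k) F c <= swapsE u v (iota (N - k).+1 k) G c + bound v k c.
Proof.
move=> uv; elim: k c => [|k IH] c kN cu inj hv FG.
  rewrite /bound /= !big_nil !addr0.
  apply: le_trans (FG c _) _.
    split=> // x xv; exact: leq_addr.
  by rewrite (bigD1 v) //= {1}/pot hv /= addr0 lerD2l addrC.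
rewrite iota_levels ?(ltnW kN) //.
set ds := iota (N - k).+1 k.
rewrite /= csubtree_level //; last by lia.
have -> : (N - (N - k.+1).+1).+1 = k.+1 by lia.
have cardl := card_level inj (ltnW kN).
have p0 : (0 : rat) < 2 ^+ k by rewrite exprn_gt0.
have cl : #|level c k.+1|%:R = 2 ^+ k :> rat by rewrite cardl natrX.
rewrite cl.
have vl r : r \in level c k.+1 -> r != v.
  by rewrite inE => /eqP h; apply: contra_eq_neq h => ->; rewrite hv; lia.
have ur r : r \in level c k.+1 -> r != u.
  rewrite inE => /eqP h; apply: contra_eq_neq h => ->.
  by rewrite cu (eqP (_ : height a a == 0%N)) // height0.
have step r : r \in level c k.+1 ->
   swapsE u v ds F (swapc c v r) <= swapsE u v ds G (swapc c v r) + bound v k (swapc c v r).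
  move=> rl; have hr : height a (c r) = k.+1 by apply/eqP; move: rl; rewrite inE.
  apply: IH => //; first exact: ltnW.
  - by rewrite swapc_o // eq_sym ur.
  - exact: swapc_inj.
  - by rewrite swapc_l.
  move=> c' [i' u' v' x']; apply: FG; split=> // x xv.
  have := x' x xv; rewrite swapc_l hr hv.
  have [->|xr] := eqVneq x r.
    by rewrite swapc_r hv hr; lia.
  by rewrite swapc_o //; lia.
apply: le_trans (_ : _ <= (2 ^+ k)^-1 * \sum_(r in level c k.+1)
     (swapsE u v ds G (swapc c v r) + bound v k (swapc c v r))) _.
  by rewrite ler_pM2l ?invr_gt0 //; apply: ler_sum.
rewrite big_split /= mulrDr lerD2l.
(* the occupants of the levels below [k.+1] are not affected by the first swap *)
have lvl r l : r \in level c k.+1 -> (l < k.+1)%N -> level (swapc c v r) l = level c l.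
  move=> rl lk; have hr : height a (c r) = k.+1 by apply/eqP; move: rl; rewrite inE.
  apply/setP => x; rewrite !inE.
  have [->|xv] := eqVneq x v; first by rewrite swapc_l hr hv; lia.
  have [->|xr] := eqVneq x r; first by rewrite swapc_r hr hv; lia.
  by rewrite swapc_o.
(* [B] tells whether the displaced [r] inherits an antipodal place from [v]. *)
set B := (if (5 <= k.+2)%N && antipodal a (c v) then true else false).
pose C := \sum_(x | x != v) pot x (c x) + ps v 1
   + \sum_(1 <= l < k.+1) (2 ^+ l.-1)^-1 * \sum_(x in level c l) (ps x l.+1 - ps x l)
   + \sum_(1 <= l < k.+1 | (5 <= l)%N) e l / 2 ^+ l.-1.
have bnd r : r \in level c k.+1 -> bound v k (swapc c v r) <=
   C + (ps r k.+2 - ps r k.+1) + (if B then om r k.+2 else 0)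
   + (if (5 <= k.+1)%N && antipodal a (c r) then e k.+1 else 0).
  move=> rl; have hr : height a (c r) = k.+1 by apply/eqP; move: rl; rewrite inE.
  rewrite /bound /C swapc_l.
  have -> : \sum_(1 <= l < k.+1) (2 ^+ l.-1)^-1 * (\sum_(x in level (swapc c v r) l) (ps x l.+1 - ps x l))
     = \sum_(1 <= l < k.+1) (2 ^+ l.-1)^-1 * \sum_(x in level c l) (ps x l.+1 - ps x l) :> rat.
    by apply: eq_big_nat => l /andP[_ lk]; rewrite lvl.
  have -> : \sum_(x | x != v) pot x (swapc c v r x) =
     \sum_(x | x != v) pot x (c x) + (pot r (c v) - pot r (c r)).
    rewrite [in LHS](bigD1 r) ?vl //= [in RHS](bigD1 r) ?vl //= swapc_r.
    under eq_bigr => x /andP[xv xr] do rewrite swapc_o //.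
    by ring.
  (* The charge that [r] may have held at its old place is nonnegative and is dropped. *)
  have po : pot r (c v) - pot r (c r) <= (ps r k.+2 - ps r k.+1) + (if B then om r k.+2 else 0).
    rewrite /pot hv hr /B.
    have : 0 <= (if (5 <= k.+1)%N && antipodal a (c r) then om r k.+1 else 0) by case: ifP.
    by case: (_ && antipodal a (c v)) => /=; lra.
  by lra.
apply: le_trans (_ : _ <= (2 ^+ k)^-1 * \sum_(r in level c k.+1)
   (C + (ps r k.+2 - ps r k.+1) + (if B then om r k.+2 else 0)
   + (if (5 <= k.+1)%N && antipodal a (c r) then e k.+1 else 0))) _.
  by rewrite ler_pM2l ?invr_gt0 //; apply: ler_sum.
set D := \sum_(x in level c k.+1) (ps x k.+2 - ps x k.+1).
have bE : bound v k.+1 c = C + (2 ^+ k)^-1 * D + (if B then e k.+2 else 0)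
    + (if (5 <= k.+1)%N then e k.+1 / 2 ^+ k else 0).
  rewrite /bound /C [in LHS]big_nat_recr //= -/D.
  rewrite [in X in _ + X = _]big_mkcond /= [in X in _ + X = _]big_nat_recr //= -big_mkcond /=.
  have -> : (if (5 <= k.+2)%N && antipodal a (c v) then e k.+2 else 0) = if B then e k.+2 else 0.
    by rewrite /B; case: (_ && _).
  by ring.
have cE : C *+ (2 ^ k)%N = 2 ^+ k * C by rewrite -(mulr_natl C) natrX.
rewrite bE 3!big_split /= sumr_const cardl cE -/D.
have a1 := avg_antipodal inj (ltnW kN).
have a2 : \sum_(i in level c k.+1) (if B then om i k.+2 else 0) <= 2 ^+ k * (if B then e k.+2 else 0).
  by case: (B); [exact: om_avg | rewrite big1 // mulr0].
set S1 := \sum_(i in level c k.+1) (if (5 <= k.+1)%N && _ then _ else _) in a1 *.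
have a1' : (2 ^+ k)^-1 * S1 <= (if (5 <= k.+1)%N then e k.+1 / 2 ^+ k else 0).
  apply: le_trans (_ : _ <= (2 ^+ k)^-1 * (if (5 <= k.+1)%N then e k.+1 else 0)) _.
    by rewrite ler_pM2l ?invr_gt0.
  by case: ifP; rewrite ?mulr0 // mulrC.
set S2 := \sum_(i in level c k.+1) (if B then _ else _) in a2 *.
have a2' : (2 ^+ k)^-1 * S2 <= (if B then e k.+2 else 0).
  by rewrite -(ler_pM2l p0) mulrA mulfV ?mul1r // gt_eqF.
have gen (p x y z w : rat) : p != 0 -> p^-1 * (p * x + y + z + w) = x + p^-1 * y + p^-1 * z + p^-1 * w.
  by move=> ?; field.
rewrite gen ?lt0r_neq0 //.
by move: a1' a2'; case: ifP; case: ifP; lra.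
Qed.
End Swaps.

(** * Recency order *)
Section Recency.
Variable V : finType.
Implicit Types (L suf : seq V) (x y v : V).

(** A node absent from [L] gets rank [(size L).+1], above every member. *)
Definition rank L x : nat := (index x L).+1.

Lemma index_rem L x v : x != v ->
  index x (rem v L) = if (index v L < index x L)%N then (index x L).-1 else index x L.
Proof.
move=> xv; elim: L => //= y L IH.
have [->|yv] /= := eqVneq y v; first by rewrite [v == x]eq_sym (negbTE xv).
by rewrite IH; case: (y == x) => //=; rewrite ltnS; case: ifP => //; lia.
Qed.

Lemma rank_step L x v : x != v ->
  rank (v :: rem v L) x = if (rank L v < rank L x)%N then rank L x else (rank L x).+1.
Proof.
move=> xv; rewrite /rank /= eq_sym (negbTE xv) index_rem // ltnS.
by case: ifP => //; lia.
Qed.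

Lemma mem_step L x v : x != v -> (x \in v :: rem v L) = (x \in L).
Proof.
move=> xv; rewrite inE (negbTE xv) /=; apply/idP/idP => [/mem_rem //|].
exact: rem_mem.
Qed.

Lemma uniq_step L v : uniq L -> uniq (v :: rem v L).
Proof. by move=> uL; rewrite /= rem_uniq // mem_rem_uniq // inE eqxx. Qed.

(** The potential may look ahead because the request sequence is fixed in advance. *)
Fixpoint next_rank L suf x : nat :=
  if suf is v :: suf' then
    if v == x then rank L x else next_rank (v :: rem v L) suf' x
  else 0.

Lemma rank_le_next L suf x : x \in suf -> (rank L x <= next_rank L suf x)%N.
Proof.
elim: suf L => //= v suf IH L; rewrite inE [x == v]eq_sym.
case: eqVneq => //= vx /IH h; apply: leq_trans (h _).
by rewrite rank_step 1?eq_sym //; case: ifP.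
Qed.

(** Apart from the two small cutoffs, [l] lies between [trunc_log 2 j + 1] and [trunc_log 2 j + 3]:
    the critical heights, where the antipodal hop is prepaid. *)
Definition inrange (l j : nat) := [&& 5 <= l, 8 <= j, 2 ^ (l - 3) <= j & j < 2 ^ l]%N.

(** Waiting time until the next request of [x], inclusive, on a clock that ticks only at repeated
    requests whose rank is in range for [l]. *)
Fixpoint tau l L suf x : nat :=
  if suf is v :: suf' then
    (((v \in L) && inrange l (rank L v)) +
     (if v == x then 0 else tau l (v :: rem v L) suf' x))%N
  else 0.

Definition awaited l L suf x :=
  [&& x \in L, x \in suf & inrange l (next_rank L suf x)].

Lemma awaited_step l L v suf x : x != v ->
  awaited l L (v :: suf) x = awaited l (v :: rem v L) suf x.
Proof.
by move=> xv; rewrite /awaited mem_step // inE (negbTE xv) /= eq_sym (negbTE xv).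
Qed.

Lemma tau_gt0 l L suf x : awaited l L suf x -> (0 < tau l L suf x)%N.
Proof.
elim: suf L => [|v suf IH] L; first by rewrite /awaited andbF.
have [->|xv] := eqVneq x v.
  by rewrite /awaited /= eqxx => /and3P[-> _ ->].
rewrite awaited_step // => /IH h /=; rewrite eq_sym (negbTE xv).
exact: leq_trans h (leq_addl _ _).
Qed.

(** An awaited node is served exactly at a tick of the clock, and a tick serves one node. *)
Lemma tau_inj l L suf x y : awaited l L suf x -> awaited l L suf y ->
  tau l L suf x = tau l L suf y -> x = y.
Proof.
elim: suf L => [|v suf IH] L; first by rewrite /awaited andbF.
have [->|xv] := eqVneq x v; have [->|yv] := eqVneq y v => //.
- rewrite (awaited_step _ _ _ yv) /= eqxx [v == y]eq_sym (negbTE yv) => _ /tau_gt0; lia.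
- rewrite (awaited_step _ _ _ xv) /= eqxx [v == x]eq_sym (negbTE xv) => /tau_gt0; lia.
rewrite !awaited_step //= ![v == _]eq_sym (negbTE xv) (negbTE yv).
by move=> ax ay /eqP; rewrite eqn_add2l => /eqP; apply: IH.
Qed.

(** The extremal case is [t] taking the values [1, ..., Q]; larger values contribute nothing, the
    subtraction being truncated. Raising [Q] by one adds one for each [x] with [t x <= Q.+1], hence
    at most [Q.+1]. *)
Lemma sum_sub_inj (D : {set V}) (t : V -> nat) Q :
  {in D, forall x, (0 < t x)%N} -> {in D &, injective t} ->
  (2 * \sum_(x in D) (Q.+1 - t x) <= Q * Q.+1)%N.
Proof.
move=> t0 tinj.
have cnt i : (#|[set x in D | (t x <= i)%N]| <= i)%N.
  rewrite -[X in (_ <= X)%N](size_iota 1) cardE -(size_map t).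
  apply: uniq_leq_size.
    rewrite map_inj_in_uniq ?enum_uniq // => x y; rewrite !mem_enum !inE => /andP[xD _] /andP[yD _].
    exact: tinj.
  move=> _ /mapP[x + ->]; rewrite mem_enum inE => /andP[xD le].
  by rewrite mem_iota t0 //=; lia.
elim: Q => [|Q IH].
  by rewrite mul0n leqn0 muln_eq0 /= sum_nat_eq0; apply/forall_inP => x /t0; case: (t x).
have -> : (\sum_(x in D) (Q.+2 - t x) = \sum_(x in D) (Q.+1 - t x) + #|[set x in D | (t x <= Q.+1)%N]|)%N.
  rewrite -sum1_card [X in (_ + X)%N](eq_bigl (fun x => (x \in D) && (t x <= Q.+1)%N)); last by move=> x; rewrite inE.
  rewrite big_mkcondr -big_split /=; apply: eq_bigr => x _; case: ifP; lia.
by have := cnt Q.+1; lia.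
Qed.
End Recency.

(** * Working set numbers *)
Section Mru.
Variable V : finType.
Implicit Types (pre : seq V) (x v w : V).

Definition mru pre : seq V := foldl (fun L v => v :: rem v L) [::] pre.

Lemma mru_rcons pre w : mru (rcons pre w) = w :: rem w (mru pre).
Proof. by rewrite /mru foldl_rcons. Qed.

Lemma mem_mru pre x : (x \in mru pre) = (x \in pre).
Proof.
elim/last_ind: pre => // pre w IH; rewrite mru_rcons mem_rcons.
have [->|xw] := eqVneq x w; first by rewrite !inE eqxx.
by rewrite mem_step // inE (negbTE xw) IH.
Qed.

Lemma uniq_mru pre : uniq (mru pre).
Proof. by elim/last_ind: pre => // pre w IH; rewrite mru_rcons uniq_step. Qed.

(** Position [i] is a request of [x] no earlier than any request of [v]; it supplies an edge of the
    communication graph since the last request of [v]. *)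
Lemma mru_recent pre v x : x \in pre -> (index x (mru pre) <= index v (mru pre))%N ->
  exists2 i, (i < size pre)%N & nth x pre i = x /\
    forall k, (k < size pre)%N -> nth x pre k = v -> (k <= i)%N.
Proof.
elim/last_ind: pre => // pre w IH; rewrite mem_rcons inE mru_rcons size_rcons.
have [->|xw] := eqVneq x w => [_ _|xp].
  by exists (size pre) => //; split=> //; rewrite nth_rcons ltnn eqxx.
have {}xp : x \in pre := xp.
have [->|vw] := eqVneq v w.
  have -> : index w (w :: rem w (mru pre)) = 0%N by rewrite /= eqxx.
  by rewrite /= eq_sym (negbTE xw).
rewrite -ltnS -[(index v _).+1]/(rank _ v) -[(index x _) < _]/(rank _ x <= rank _ v).
rewrite !rank_step // => le.
have xL : x \in mru pre by rewrite mem_mru.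
have ix : (index x (mru pre) < size (mru pre))%N by rewrite index_mem.
have wv : v \in mru pre -> index v (mru pre) != index w (mru pre).
  move=> vL; apply: contra vw => /eqP e; have wL : w \in mru pre by rewrite -index_mem -e index_mem.
  by rewrite -(nth_index v vL) e nth_index.
have le' : (index x (mru pre) <= index v (mru pre))%N.
  have [vL|vL] := boolP (v \in mru pre); last first.
    by rewrite (memNindex vL); exact: ltnW.
  have := wv vL; move: le; rewrite /rank; clear -ix.
  by case: ifP; case: ifP; lia.
have [i ip [ei ki]] := IH xp le'.
exists i; first exact: ltnW.
split=> [|k]; first by rewrite nth_rcons ip.
rewrite ltnS leq_eqVlt => /orP[/eqP ->|kp]; last by rewrite nth_rcons kp; apply: ki.
by rewrite nth_rcons ltnn eqxx => e; rewrite e eqxx in vw.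
Qed.
End Mru.

Section WorkingSet.
Variables (N : nat) (V : finType) (u : V).
Variables (pre suf : seq V) (v : V).
Hypotheses (vu : v != u) (uF : u \notin pre).
Local Notation s := [seq (u, x) | x <- pre ++ v :: suf].
Local Notation t := (size pre).+1.

Lemma nth_request p j : (j < size pre)%N -> nth p s j = (u, nth u pre j).
Proof.
move=> jp; rewrite (nth_map u) ?nth_cat ?jp //.
by rewrite size_cat; apply: leq_trans jp (leq_addr _ _).
Qed.

Lemma same_pairE x y : y != u -> same_pair (u, x) u y = (x == y).
Proof. by move=> yu; rewrite /same_pair !xpair_eqE eqxx /= [u == y]eq_sym (negbTE yu) orbF. Qed.

Lemma lt_size j : (j < size pre)%N -> (j < size s)%N.
Proof. by move=> jp; rewrite size_map size_cat; apply: leq_trans jp (leq_addr _ _). Qed.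

Lemma edge_request t' j : (j < size pre)%N -> (t' <= j.+1)%N -> nth u pre j != u ->
  cedge s t' t u (nth u pre j).
Proof.
move=> jp le xu; apply/existsP; exists (Ordinal (lt_size jp)) => /=.
by rewrite le ltnS jp nth_request // same_pairE // eqxx.
Qed.

Lemma comm_before_mem : comm_before s t u v = (v \in pre).
Proof.
apply/existsP/idP => [[j /andP[jp]]|vp].
  rewrite ltnS in jp; rewrite nth_request // same_pairE // => /eqP <-; exact: mem_nth.
have jp : (index v pre < size pre)%N by rewrite index_mem.
by exists (Ordinal (lt_size jp)); rewrite /= ltnS jp nth_request // same_pairE // nth_index // eqxx.
Qed.

Lemma card_comp_rank : v \in pre -> (rank (mru pre) v < #|Defs.comp s (last_comm s t u v) t u|)%N.
Proof.
move=> vp; have vL : v \in mru pre by rewrite mem_mru.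
have rL : (rank (mru pre) v <= size (mru pre))%N by rewrite /rank index_mem.
pose T := u :: take (rank (mru pre) v) (mru pre).
have uT : uniq T.
  rewrite /= take_uniq ?uniq_mru // andbT; apply: contra uF => /mem_take.
  by rewrite mem_mru.
have sT : size T = (rank (mru pre) v).+1 by rewrite /T [LHS]/= size_takel.
rewrite -sT -(card_uniqP uT); apply: subset_leq_card; apply/subsetP => x.
rewrite [x \in Defs.comp _ _ _ _]inE inE => /orP[/eqP ->|xt]; first exact: connect0.
have xL := mem_take xt; have xp : x \in pre by rewrite -mem_mru.
have le : (index x (mru pre) <= index v (mru pre))%N by rewrite in_take // in xt.
have [i ip [ei ki]] := mru_recent xp le.
have eu : nth u pre i = x by rewrite -ei; apply: set_nth_default.
apply: connect1; rewrite -eu; apply: edge_request => //; last first.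
  by rewrite eu; apply: contraNneq uF => <-.
(* [last_comm] is a maximum over the past requests of [v], all at positions at most [i]; times are
   positions plus one. *)
apply/bigmax_leqP => k /andP[kt]; rewrite ltnS in kt.
rewrite nth_request // same_pairE // => /eqP kv; rewrite ltnS; apply: ki => //.
by apply: etrans kv; apply: set_nth_default.
Qed.

(** Every earlier edge joins the server to a member of [pre], so [u :: pre] is closed under
    edges. *)
Lemma notin_comp : v \notin pre -> v \notin Defs.comp s 0 t u.
Proof.
move=> vp; rewrite inE; apply/negP => conn.
have cl : closed (cedge s 0 t) [pred x | x \in u :: pre].
  move=> x y /existsP[j /andP[/= jp]]; rewrite ltnS in jp; rewrite nth_request //.
  have m : nth u pre j \in u :: pre by rewrite inE mem_nth ?orbT.
  have mu : u \in u :: pre by rewrite inE eqxx.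
  by rewrite /same_pair !xpair_eqE => /orP[] /andP[/eqP <- /eqP <-]; rewrite !inE in m mu *; rewrite m mu.
have := closed_connect cl conn; rewrite !inE eqxx (negbTE vu) (negbTE vp).
by [].
Qed.

Lemma uplog_gt F n : (2 ^ F < n)%N -> (F < up_log 2 n)%N.
Proof.
move=> lt; rewrite ltnNge; apply/negP => le.
have := @up_logP 2 n isT => /leq_trans /(_ (_ : 2 ^ up_log 2 n <= 2 ^ F)%N).
by rewrite leq_exp2l // le => /(_ isT); rewrite leqNgt lt.
Qed.

Lemma WS_repeat (c : state N V) : v \in pre ->
  ((trunc_log 2 (rank (mru pre) v)).+1 <= up_log 2 (WSnum s c t u v))%N.
Proof.
move=> vp; rewrite /WSnum comm_before_mem vp; apply: uplog_gt.
by apply: leq_ltn_trans (card_comp_rank vp); apply: trunc_logP.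
Qed.

Lemma WS_fresh (c : state N V) : v \notin pre ->
  (height (c u) (c v) <= up_log 2 (WSnum s c t u v))%N.
Proof.
move=> vp; rewrite /WSnum comm_before_mem (negbTE vp) (negbTE (notin_comp vp)).
rewrite -{1}(@up_expnK 2 (height (c u) (c v))) //; apply: leq_up_log.
exact: leq_maxl.
Qed.
End WorkingSet.

Local Open Scope ring_scope.
Delimit Scope Z_scope with zz.

(** * The quadratic potential *)
(** [kap] and [mu] weight the two martingales combined in [quad]. The identities below hold for any
    values; these are chosen by range of [J] to make [request_certified] true. *)
Definition kap (J : nat) : rat :=
  if (J < 4)%N then 3/5 else if (J < 8)%N then 2/25 else if (J < 16)%N then 1/2 else 7/8.
Definition mu (J : nat) : rat :=
  if (J < 4)%N then 17/20 else if (J < 8)%N then 8/5 else if (J < 16)%N then 1/4 else 0.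

Lemma kap_gt0 J : 0 < kap J. Proof. by rewrite /kap; case: (J < 4)%N; [lra | case: (J < 8)%N; [lra | case: (J < 16)%N; lra]]. Qed.
Lemma mu_ge0 J : 0 <= mu J. Proof. by rewrite /mu; case: (J < 4)%N; [lra | case: (J < 8)%N; [lra | case: (J < 16)%N; lra]]. Qed.

(** [H] stands for [2 ^ height.-1] and [s] for the rank increases still to come. Both [H + s] and
    [H^2 + 3 H s + 3/2 s (s - 1)] solve [f s H + (f s (2H) - f s H) / H = f (s+1) H]; the constants
    make the combination vanish at [s = J - 1], [H = 1]. *)
Definition quad (J : nat) (s H : rat) : rat :=
  (kap J * (H ^+ 2 + 3 * H * s + 3/2 * s * (s - 1))
   + (mu J * J%:R - 3/2 * kap J * (J%:R - 1)) * (H + s)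
   - mu J * J%:R ^+ 2 - kap J) / J%:R ^+ 2.

Definition rise (J : nat) (s H : rat) : rat :=
  (kap J * (3 * H + 3 * s - 3/2 * (J%:R - 1)) + mu J * J%:R) / J%:R ^+ 2.

Lemma quad_double J s H : quad J s (2 * H) - quad J s H = H * rise J s H.
Proof. by rewrite /quad /rise -mulrBl [RHS]mulrA; congr (_ * _); field. Qed.

Lemma quad_succ J s H : quad J (s + 1) H - quad J s H = rise J s H.
Proof. by rewrite /quad /rise -mulrBl; congr (_ * _); field. Qed.

(** A node just served has rank 1 and height 1, with [J.-1] rank increases ahead; it must start
    without potential. *)
Lemma quad_start J : (0 < J)%N -> quad J J.-1%:R 1 = 0.
Proof.
case: J => // n _; rewrite /quad -natr1 /=; apply/eqP; rewrite mulf_eq0; apply/orP; left.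
by apply/eqP; field.
Qed.

Lemma rise_mono J s H H' : H <= H' -> rise J s H <= rise J s H'.
Proof.
move=> le; rewrite /rise ler_wpM2r ?invr_ge0 ?exprn_ge0 //.
by rewrite lerD2r ler_wpM2l ?(ltW (kap_gt0 J)) //; lra.
Qed.

(** * Monotone lower envelope of the quadratic *)

Section Envelope.
Variable J : nat.
Hypothesis J0 : (0 < J)%N.

Definition lquad (s h : nat) : rat := quad J s%:R (2 ^+ h.-1).

(** Minimum of the quadratic over all heights from [h] on. A window of [J.+1] heights suffices,
    since [lquad] is nondecreasing from height [J] on. *)
Definition env (s h : nat) : rat :=
  lquad s (h + [arg min_(i < (ord0 : 'I_J.+1)) lquad s (h + i)]%O).

Lemma lquad_double s h : (0 < h)%N ->
  lquad s h.+1 - lquad s h = 2 ^+ h.-1 * rise J s%:R (2 ^+ h.-1).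
Proof. by case: h => // h _; rewrite /lquad /= exprS quad_double. Qed.

Lemma lquad_incr s l : (J <= l)%N -> lquad s l <= lquad s l.+1.
Proof.
move=> Jl; have l0 : (0 < l)%N by lia.
rewrite -subr_ge0 lquad_double //.
rewrite mulr_ge0 ?exprn_ge0 // /rise divr_ge0 ?exprn_ge0 //.
rewrite addr_ge0 ?mulr_ge0 ?mu_ge0 ?(ltW (kap_gt0 J)) //.
have : J%:R <= 2 * 2 ^+ l.-1 :> rat.
  rewrite -exprS prednK // -natrX ler_nat; apply: leq_trans Jl _; exact/ltnW/ltn_expl.
by have : 0 <= s%:R :> rat by []; lra.
Qed.

Lemma env_le s h k : (h <= k)%N -> env s h <= lquad s k.
Proof.
move=> hk; rewrite /env.
case: arg_minP => // i _ imin.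
have [le|lt] := leqP (k - h) J.
  by have := imin (Ordinal (le : (k - h < J.+1)%N)) isT; rewrite /= subnKC.
apply: le_trans (imin ord_max isT) _ => /=.
rewrite -(subnKC (_ : h + J <= k)%N); last by lia.
elim: (k - (h + J))%N => [|n IH]; first by rewrite addn0.
apply: le_trans IH _; rewrite addnS; apply: lquad_incr; lia.
Qed.

Lemma env_eq s h : exists2 k, (h <= k)%N & env s h = lquad s k.
Proof. by eexists; last reflexivity; exact: leq_addr. Qed.

Lemma env_mono s h : env s h <= env s h.+1.
Proof. by have [k hk ->] := env_eq s h.+1; apply: env_le; lia. Qed.

Lemma lquad_martingale s h : (0 < h)%N ->
  lquad s h + (2 ^+ h.-1)^-1 * (lquad s h.+1 - lquad s h) = lquad s.+1 h.
Proof.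
move=> h0; rewrite lquad_double // mulKf ?expf_neq0 // -quad_succ natr1.
by rewrite /lquad addrC subrK.
Qed.

(* The value at [s.+1] is a value of the quadratic at some level [k >= h],
   hence an average of two values at levels [>= h] for [s]. *)
Lemma env_drift s h : (0 < h)%N ->
  env s h + (2 ^+ h.-1)^-1 * (env s h.+1 - env s h) <= env s.+1 h.
Proof.
move=> h0; have [k hk ->] := env_eq s.+1 h.
have p n : 0 < (2 : rat) ^+ n by rewrite exprn_gt0.
have pV n : (2 ^+ n)^-1 <= 1 :> rat by rewrite invf_le1 ?p // exprn_ege1.
have mix (w x y z : rat) : 0 <= w -> w <= 1 -> x <= y -> x <= z -> x <= y + w * (z - y) by nra.
rewrite -lquad_martingale; last by lia.
have [hk'|hk'] := ltnP h k.
  apply: le_trans (_ : _ <= env s h.+1) _.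
    by have := env_mono s h; have := pV h.-1; have := p h.-1; rewrite -invr_gt0; nra.
  by apply: mix; rewrite ?invr_ge0 ?(ltW (p _)) ?pV //; apply: env_le; lia.
have -> : k = h by lia.
have := env_le s (leqnn h); have := env_le s (leqnn h.+1); have := pV h.-1.
by have := p h.-1; rewrite -invr_gt0; nra.
Qed.

Lemma env_succ s h : (0 < h)%N -> env s h <= env s.+1 h.
Proof.
move=> h0; apply: le_trans (env_drift s h0); rewrite lerDl mulr_ge0 ?invr_ge0 ?exprn_ge0 //.
by rewrite subr_ge0 env_mono.
Qed.

(** If the minimum is attained above [h], moving up changes nothing for the worse; otherwise [env]
    equals the quadratic at [h], whose scaled increment is [rise]. *)
Lemma env_rise s h : (0 < h)%N ->
  (2 ^+ h.-1)^-1 * (env s h.+1 - env s h) <= Num.max 0 (rise J s%:R (2 ^+ h.-1)).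
Proof.
move=> h0; rewrite le_max.
have p : 0 < (2 : rat) ^- h.-1 by rewrite invr_gt0 exprn_gt0.
have [k hk E] := env_eq s h.
have [hk'|hk'] := ltnP h k.
  by apply/orP; left; rewrite pmulr_rle0 // subr_le0 E env_le.
apply/orP; right; have kh : k = h by lia.
rewrite E kh; apply: le_trans (_ : _ <= 2 ^- h.-1 * (lquad s h.+1 - lquad s h)) _.
  by rewrite ler_pM2l // lerD2r env_le.
by rewrite lquad_double // mulKf // expf_neq0.
Qed.

Lemma env_start : env J.-1 1 <= 0.
Proof. by rewrite -(quad_start J0); apply: (env_le J.-1 (leqnn 1)). Qed.
End Envelope.

(** * Certified numerical inequality *)

Definition eps (l : nat) : rat := if (l <= 5)%N then 3/5 else 22/25.
(** Normalized so that the charges [weight l * (Q + 1 - t)] for [t = 1, ..., Q], with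
    [Q = 2 ^ (l - 2)], average to [eps l]. *)
Definition weight (l : nat) : rat := 2 * eps l / (2 ^+ (l - 2) + 1).
Definition tick N j : rat := \sum_(5 <= l < N.+1 | inrange l j) weight l.
Definition refresh h : rat := \sum_(1 <= l < h | (5 <= l)%N) eps l / 2 ^+ l.-1.

(** Here [B] bounds the potential gained by other nodes. When an antipodal [v] in range is served,
    its charge and its saved share of [tick] make [2 * eps h]; one [eps h] goes to its successor,
    leaving [eps h] on the right. Out of range, the successor's [eps h] is unfunded. *)
Definition request_ok N j h (B : rat) :=
  let G := h%:R - (trunc_log 2 j).+2%:R + B - env j 0 h + tick N j in
  if (h < 5)%N then G <= 0
  else if inrange h j then G + refresh h <= eps h
  else G + refresh h + eps h <= 0.

(** The cardinality bound established in [card_b_type]. *)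
Definition crowd j h : nat := (2 ^ h.-1 - 1 - minn j.-1 h.-1)%N.

(** [m i] must hold for every possible future rank [J]; [2 ^ (h - 2)] belongs to height [h.-1], the
    largest at which a node can still be displaced. *)
Definition majorant j h (m : nat -> rat) :=
  (forall i, 0 <= m i) /\
  (forall i J, (j < i <= j + crowd j h)%N -> (i <= J)%N ->
     rise J (J%:R - i%:R) (2 ^+ (h - 2)) <= m i).

Definition crowd_sum j h (m : nat -> rat) : rat := \sum_(j.+1 <= i < (j + crowd j h).+1) m i.

(* Integer certificate: all quantities are scaled by [10^6] and rounded in the safe direction. *)
Module Cert.
Local Open Scope Z_scope.
Definition S := 1000000.
Definition K (J : Z) := if J <? 4 then 120 else if J <? 8 then 16 else if J <? 16 then 100 else 175.
Definition U (J : Z) := if J <? 4 then 170 else if J <? 8 then 320 else if J <? 16 then 50 else 0.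
Definition up (n d : Z) := n / d + 1.
(** Supremum of [rise] over [J >= max(i, 16)], in the closed form of [quad_sup]. *)
Definition big (A i : Z) :=
  let t := Z.max i 16 in let x := 6 * i - 6 * A - 3 in
  if 2 * x <=? 3 * t then up (S * (7 * (3 * t - x))) (16 * t * t) else up (S * 63) (64 * x).
Definition small1 (A i J : Z) :=
  if i <=? J then up (S * (K J * (6 * A - 6 * i + 3 * J + 3) + 2 * U J * J)) (400 * J * J) else 0.
Fixpoint small (A i J : Z) (n : nat) :=
  match n with O => 0 | Datatypes.S n => Z.max (small1 A i J) (small A i (J + 1) n) end.
Definition m (A i : Z) :=
  if i <? 16 then Z.max (big A i) (small A i 1 15) else Z.max 0 (big A i).
Fixpoint msum (A i : Z) (n : nat) :=
  match n with O => 0 | Datatypes.S n => m A i + msum A (i + 1) n end.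
(** Minimum of the convex quadratic over real [x >= H]: at [H] when [H] is right of the vertex,
    otherwise bounded by the vertex value. *)
Definition envlow (j H : Z) :=
  let c := 2 * U j * j - 3 * K j * (j - 1) in
  let X := if 0 <=? 4 * K j * H + c then 2 * K j * H * H + c * H else - (up (c * c) (8 * K j)) in
  (S * (X - 2 * U j * j * j - 2 * K j)) / (400 * j * j).
Definition eps (l : nat) := if (l <=? 5)%nat then 600000 else 880000.
Definition inr (l : nat) (j : Z) := (5 <=? l)%nat && (8 <=? j) && (2 ^ Z.of_nat (l - 3) <=? j) && (j <? 2 ^ Z.of_nat l).
Definition weight (l : nat) := up (2 * eps l) (2 ^ Z.of_nat (l - 2) + 1).
Fixpoint sumf (f : nat -> Z) (l n : nat) := match n with O => 0 | Datatypes.S n => f l + sumf f (Datatypes.S l) n end.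
(** Enough terms for [j < 128], where a height in range is at most 9. *)
Definition tick (j : Z) := sumf (fun l => if inr l j then weight l else 0) 5 6.
Definition refresh (h : nat) := sumf (fun l => up (eps l) (2 ^ Z.of_nat (l - 1))) 5 (h - 5).
Definition ok (jn h : nat) :=
  let j := Z.of_nat jn in
  let B := msum (2 ^ Z.of_nat (h - 2)) (j + 1) (2 ^ (h - 1) - 1 - Nat.min (jn - 1) (h - 1))%nat in
  let G := (Z.of_nat h - Z.log2 j - 2) * S + B - envlow j (2 ^ Z.of_nat (h - 1)) + tick j in
  if (h <? 5)%nat then G <=? 0
  else if inr h j then G + refresh h <=? eps h
  else G + refresh h + eps h <=? 0.
(** Below 16, height is bounded by rank; from 16 on, greater heights fall under [certified_high]. *)
Definition hmax (j : nat) := if (j <? 16)%nat then j else (Z.to_nat (Z.log2 (Z.of_nat j)) + 3)%nat.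
Definition all_ok := List.forallb (fun j => List.forallb (ok j) (List.seq 1 (hmax j))) (List.seq 1 127).
Lemma all_okP : all_ok = true.
Proof. vm_compute. reflexivity. Qed.
End Cert.


(** * Transfer of the integer certificate to the rationals *)

Fact zq_key : unit. Proof. exact: tt. Qed.
Definition zq : Z -> rat := locked_with zq_key (fun z => (int_of_Z z)%:~R).
Lemma zqE z : zq z = (int_of_Z z)%:~R. Proof. by rewrite /zq unlock. Qed.

Lemma zqD x y : zq (x + y)%zz = zq x + zq y.
Proof. by rewrite !zqE -intrD; congr (_%:~R); lia. Qed.
Lemma zqM x y : zq (x * y)%zz = zq x * zq y.
Proof. by rewrite !zqE -intrM; congr (_%:~R); lia. Qed.
Lemma zqN x : zq (- x)%zz = - zq x.
Proof. by rewrite !zqE -mulrNz; congr (_%:~R); lia. Qed.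
Lemma zqB x y : zq (x - y)%zz = zq x - zq y.
Proof. by rewrite -zqN -zqD. Qed.
Lemma zq_nat (n : nat) : zq (Z.of_nat n) = n%:R.
Proof. by rewrite !zqE -[n%:R]/(n%:~R); congr (_%:~R); lia. Qed.
Lemma zq_le x y : (zq x <= zq y) = (x <=? y)%zz.
Proof. by rewrite !zqE ler_int; lia. Qed.
Lemma zq_lt x y : (zq x < zq y) = (x <? y)%zz.
Proof. by rewrite !zqE ltr_int; lia. Qed.
Lemma zq0 : zq 0%zz = 0. Proof. by rewrite zqE. Qed.
Lemma zq_exp2 (k : nat) : zq (2 ^ Z.of_nat k)%zz = 2 ^+ k.
Proof.
elim: k => [|k IH]; first by rewrite zqE.
rewrite Nat2Z.inj_succ Z.pow_succ_r; last by lia.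
by rewrite zqM IH exprS (zq_nat 2).
Qed.

Lemma up_ge n d : (0 < d)%zz -> zq n <= zq (Cert.up n d) * zq d.
Proof.
move=> d0; rewrite -zqM zq_le /Cert.up; apply/Z.leb_le.
have := Z.mod_pos_bound n d d0; have := Z.div_mod n d; lia.
Qed.

Lemma div_up n d x : (0 < d)%zz -> x * zq d <= zq n -> x <= zq (Cert.up n d).
Proof.
move=> d0 le; have dq : 0 < zq d by rewrite -zq0 zq_lt; lia.
by rewrite -(ler_pM2r dq); apply: le_trans le (up_ge n d0).
Qed.

Lemma div_floor n d x : (0 < d)%zz -> zq n <= x * zq d -> zq (n / d)%zz <= x.
Proof.
move=> d0 le; have dq : 0 < zq d by rewrite -zq0 zq_lt; lia.
rewrite -(ler_pM2r dq); apply: le_trans le; rewrite -zqM zq_le; apply/Z.leb_le.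
have := Z.mod_pos_bound n d d0; have := Z.div_mod n d; lia.
Qed.

Definition Sq : rat := zq Cert.S.
Lemma Sq_gt0 : 0 < Sq. Proof. by rewrite /Sq -zq0 zq_lt. Qed.

Lemma K_kap J : zq (Cert.K (Z.of_nat J)) = 200 * kap J.
Proof.
have c (z : Z) n : z = Z.of_nat n -> zq z = n%:R by move=> ->; exact: zq_nat.
rewrite /Cert.K /kap.
case: (ltnP J 4) => h4.
  have -> : (Z.of_nat J <? 4)%zz = true by lia.
  by rewrite (c _ 120%N) //; lra.
have -> : (Z.of_nat J <? 4)%zz = false by lia.
case: (ltnP J 8) => h8.
  have -> : (Z.of_nat J <? 8)%zz = true by lia.
  by rewrite (c _ 16%N) //; lra.
have -> : (Z.of_nat J <? 8)%zz = false by lia.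
case: (ltnP J 16) => h16.
  have -> : (Z.of_nat J <? 16)%zz = true by lia.
  by rewrite (c _ 100%N) //; lra.
have -> : (Z.of_nat J <? 16)%zz = false by lia.
by rewrite (c _ 175%N) //; lra.
Qed.

Lemma U_mu J : zq (Cert.U (Z.of_nat J)) = 200 * mu J.
Proof.
have c (z : Z) n : z = Z.of_nat n -> zq z = n%:R by move=> ->; exact: zq_nat.
rewrite /Cert.U /mu.
case: (ltnP J 4) => h4.
  have -> : (Z.of_nat J <? 4)%zz = true by lia.
  by rewrite (c _ 170%N) //; lra.
have -> : (Z.of_nat J <? 4)%zz = false by lia.
case: (ltnP J 8) => h8.
  have -> : (Z.of_nat J <? 8)%zz = true by lia.
  by rewrite (c _ 320%N) //; lra.
have -> : (Z.of_nat J <? 8)%zz = false by lia.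
case: (ltnP J 16) => h16.
  have -> : (Z.of_nat J <? 16)%zz = true by lia.
  by rewrite (c _ 50%N) //; lra.
have -> : (Z.of_nat J <? 16)%zz = false by lia.
by rewrite (c _ 0%N) //; lra.
Qed.

Lemma frac_le (R : realFieldType) (a b c d : R) :
  0 < b -> 0 < d -> a * d <= c * b -> a / b <= c / d.
Proof. by move=> b0 d0 le; rewrite ler_pdivrMr // mulrAC ler_pdivlMr. Qed.

(** For [x > 0] the map [w -> (3 w - x) / w^2] peaks at [w = 2x/3] with value [9 / (4x)]; when the
    peak is left of [t], or [x <= 0], it decreases from [t] on. *)
Lemma quad_sup (R : realFieldType) (t x w y : R) : 0 < t -> t <= w -> x <= y ->
  7/16 * (3 * w - y) / w ^+ 2 <=
    if 2 * x <= 3 * t then 7/16 * (3 * t - x) / t ^+ 2 else 63 / (64 * x).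
Proof.
move=> t0 tw xy; have w0 := lt_le_trans t0 tw.
have w2 : 0 < w ^+ 2 by rewrite exprn_gt0.
have t2 : 0 < t ^+ 2 by rewrite exprn_gt0.
apply: le_trans (_ : _ <= 7/16 * (3 * w - x) / w ^+ 2) _.
  by rewrite ler_pM2r ?invr_gt0 //; lra.
case: (lerP (2 * x) (3 * t)) => le.
  apply: frac_le => //; rewrite -subr_ge0.
  have -> : 7/16 * (3 * t - x) * w ^+ 2 - 7/16 * (3 * w - x) * t ^+ 2 =
     7/16 * ((w - t) * (3 * t * w - x * (w + t))) by ring.
  apply: mulr_ge0; first lra.
  apply: mulr_ge0; first lra.
  have : 0 <= (3 / 2 * t - x) * (w + t) by apply: mulr_ge0; lra.
  have : 0 <= t * (w - t) by apply: mulr_ge0; lra.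
  lra.
have x0 : 0 < x by lra.
apply: frac_le => //; first lra.
have := sqr_ge0 (3 * w - 2 * x); rewrite !expr2; lra.
Qed.

Lemma scale_le (R : realFieldType) (s a b l : R) : 0 < l -> s * a <= b -> s * (a / l) <= b / l.
Proof. by move=> l0 le; rewrite mulrA ler_pM2r ?invr_gt0. Qed.

Lemma eq_ler (R : numDomainType) (x y : R) : x = y -> x <= y. Proof. by move->. Qed.

Lemma kap_large J : (16 <= J)%N -> kap J = 7/8.
Proof.
move=> h; rewrite /kap; have -> : (J < 4)%N = false by lia.
have -> : (J < 8)%N = false by lia. by have -> : (J < 16)%N = false by lia.
Qed.
Lemma mu_large J : (16 <= J)%N -> mu J = 0.
Proof.
move=> h; rewrite /mu; have -> : (J < 4)%N = false by lia.
have -> : (J < 8)%N = false by lia. by have -> : (J < 16)%N = false by lia.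
Qed.

(** For [J >= 16], [rise] is homogeneous of degree -1 in [J] and [6 i - 6 A - 3], so dividing both
    by [lam] reduces it to the certified values. [lam] is 1 for small ranks and a power of two for
    dyadic blocks. *)
Lemma rise_big (J i A A0 i0 : nat) (lam : rat) : (16 <= J)%N -> 0 < lam ->
  lam * (maxn i0 16)%:R <= J%:R ->
  lam * (6 * i0%:R - 6 * A0%:R - 3) <= 6 * i%:R - 6 * A%:R - 3 ->
  Sq * rise J (J%:R - i%:R) A%:R <= zq (Cert.big (Z.of_nat A0) (Z.of_nat i0)) / lam.
Proof.
move=> J16 lam0 tJ xle.
pose w : rat := J%:R / lam; pose y : rat := (6 * i%:R - 6 * A%:R - 3) / lam.
have J0 : 0 < J%:R :> rat by rewrite ltr0n; lia.
have w0 : 0 < w by rewrite divr_gt0.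
have -> : rise J (J%:R - i%:R) A%:R = (7/16 * (3 * w - y) / w ^+ 2) / lam.
  rewrite /rise kap_large // mu_large //.
  rewrite /w /y; field; apply/andP; split; lra.
refine (scale_le lam0 _).
set t := maxn i0 16 in tJ *.
have t0 : 0 < t%:R :> rat by rewrite ltr0n; lia.
have tw : t%:R <= w by rewrite ler_pdivlMr // mulrC.
have xy : 6 * i0%:R - 6 * A0%:R - 3 <= y by rewrite (ler_pdivlMr _ _ lam0) mulrC.
apply: le_trans (ler_wpM2l (ltW Sq_gt0) (quad_sup t0 tw xy)) _.
have n (k : nat) : zq (Z.of_nat k) = k%:R by exact: zq_nat.
have n2 : zq 2%zz = 2 by exact: (n 2%N). have n3 : zq 3%zz = 3 by exact: (n 3%N).
have n6 : zq 6%zz = 6 by exact: (n 6%N). have n7 : zq 7%zz = 7 by exact: (n 7%N).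
have n16 : zq 16%zz = 16 by exact: (n 16%N).
have n63 : zq 63%zz = 63 by exact: (n 63%N). have n64 : zq 64%zz = 64 by exact: (n 64%N).
have tE : zq (Z.max (Z.of_nat i0) 16%zz) = t%:R.
  by rewrite -zq_nat /t; congr zq; lia.
rewrite /Cert.big; set tz := Z.max _ _ in tE *.
set xz := (6 * Z.of_nat i0 - 6 * Z.of_nat A0 - 3)%zz.
have xE : zq xz = 6 * i0%:R - 6 * A0%:R - 3 by rewrite /xz !zqB !zqM !zq_nat n6 n3.
rewrite -xE -tE.
have -> : (2 * zq xz <= 3 * zq tz) = (2 * xz <=? 3 * tz)%zz by rewrite -n2 -n3 -!zqM zq_le.
have tz0 : (0 < tz)%zz by rewrite /tz; lia.
case: ifP => le; apply: div_up.
- lia.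
- rewrite !zqM zqB zqM n16 n7 n3 -/Sq; apply: eq_ler; field.
  by rewrite tE gt_eqF.
- lia.
- rewrite !zqM n64 n63 -/Sq; apply: eq_ler; field.
  apply/eqP => E; have : xz = 0%zz; last lia.
  by apply: Z.le_antisymm; apply/Z.leb_le; rewrite -zq_le E zq0.
Qed.


Lemma zqS z n : z = Z.of_nat n -> zq z = n%:R. Proof. by move->; exact: zq_nat. Qed.

Lemma rise_small1 A i J : (i <= J)%N -> (0 < J)%N ->
  Sq * rise J (J%:R - i%:R) A%:R <= zq (Cert.small1 (Z.of_nat A) (Z.of_nat i) (Z.of_nat J)).
Proof.
move=> iJ J0; rewrite /Cert.small1; have -> : (Z.of_nat i <=? Z.of_nat J)%zz = true by lia.
apply: div_up; first by nia.
have Jn : J%:R != 0 :> rat by rewrite pnatr_eq0; lia.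
rewrite !(zqB, zqD, zqM, K_kap, U_mu, zq_nat) -/Sq.
rewrite (zqS (erefl : 6%zz = Z.of_nat 6)) (zqS (erefl : 3%zz = Z.of_nat 3)).
rewrite (zqS (erefl : 2%zz = Z.of_nat 2)).
have -> : zq 400 = 400 by rewrite (zqS (n := 400)).
by apply: eq_ler; rewrite /rise; field.
Qed.

Lemma small_max A i J n k : (k < n)%N -> 
  (Cert.small1 A i (J + Z.of_nat k) <= Cert.small A i J n)%zz.
Proof.
elim: n J k => // n IH J [|k] kn /=; first by rewrite Z.add_0_r; lia.
have := IH (J + 1)%zz k kn.
have -> : (J + 1 + Z.of_nat k = J + Z.pos (Pos.of_succ_nat k))%zz by lia.
lia.
Qed.

Lemma small_ge0 A i J n : (0 <= Cert.small A i J n)%zz.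
Proof. elim: n J => //= n IH J; have := IH (J + 1)%zz; lia. Qed.

Lemma Cert_m_ge0 A i : (0 <= Cert.m A i)%zz.
Proof. rewrite /Cert.m; case: ifP => _; have := @small_ge0 A i 1 15; lia. Qed.

Lemma rise_m A i J : (0 < i)%N -> (i <= J)%N ->
  rise J (J%:R - i%:R) A%:R <= zq (Cert.m (Z.of_nat A) (Z.of_nat i)) / Sq.
Proof.
move=> i0 iJ.
suff le : Sq * rise J (J%:R - i%:R) A%:R <= zq (Cert.m (Z.of_nat A) (Z.of_nat i)).
  by rewrite (ler_pdivlMr _ _ Sq_gt0) mulrC.
have [J16|J16] := leqP 16 J.
  apply: le_trans (_ : _ <= zq (Cert.big (Z.of_nat A) (Z.of_nat i)) / 1) _.
    by apply: (rise_big J16 ltr01); rewrite mul1r ?lexx // ler_nat; lia.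
  rewrite divr1 zq_le /Cert.m; case: ifP => _; lia.
have le : (Cert.small1 (Z.of_nat A) (Z.of_nat i) (Z.of_nat J) <= Cert.m (Z.of_nat A) (Z.of_nat i))%zz.
  have := @small_max (Z.of_nat A) (Z.of_nat i) 1 15 J.-1.
  have -> : (1 + Z.of_nat J.-1 = Z.of_nat J)%zz by lia.
  move=> /(_ ltac:(lia)); rewrite /Cert.m; have -> : (Z.of_nat i <? 16)%zz = true by lia.
  lia.
apply: le_trans (rise_small1 A iJ _) _; first lia.
by rewrite zq_le; lia.
Qed.

Lemma zq_msum A i n : zq (Cert.msum A (Z.of_nat i) n) = \sum_(i <= l < i + n) zq (Cert.m A (Z.of_nat l)).
Proof.
elim: n i => [|n IH] i; first by rewrite addn0 big_geq // zq0.
rewrite big_ltn; last by lia.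
by rewrite zqD -addSnnS -IH; congr (_ + zq (Cert.msum _ _ _)); lia.
Qed.

Lemma env_ge J s h B : (0 < J)%N -> (0 < h)%N ->
  (forall x, 2 ^+ h.-1 <= x -> B <= quad J s%:R x) -> B <= env J s h.
Proof.
move=> J0 h0 le; have [k hk ->] := env_eq J s h; apply: le.
by rewrite ler_eXn2l // ?ltr1n //; lia.
Qed.

Lemma quad_scaled J x : (0 < J)%N ->
  400 * J%:R ^+ 2 * quad J 0 x =
  2 * (200 * kap J) * x ^+ 2 + (2 * (200 * mu J) * J%:R - 3 * (200 * kap J) * (J%:R - 1)) * x
  - 2 * (200 * mu J) * J%:R ^+ 2 - 2 * (200 * kap J).
Proof. by move=> J0; rewrite /quad; field; rewrite pnatr_eq0; lia. Qed.

Lemma quad_vertex (R : realFieldType) (k c x : R) : 0 < k -> - (c ^+ 2 / (8 * k)) <= 2 * k * x ^+ 2 + c * x.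
Proof.
move=> k0; rewrite -subr_ge0.
have -> : 2 * k * x ^+ 2 + c * x - - (c ^+ 2 / (8 * k)) = (4 * k * x + c) ^+ 2 / (8 * k).
  by field; lra.
by rewrite divr_ge0 ?sqr_ge0 //; lra.
Qed.

Lemma quad_right (R : realFieldType) (k c x y : R) : 0 < k -> 0 <= 4 * k * x + c -> x <= y ->
  2 * k * x ^+ 2 + c * x <= 2 * k * y ^+ 2 + c * y.
Proof.
move=> k0 h xy; rewrite -subr_ge0.
have -> : 2 * k * y ^+ 2 + c * y - (2 * k * x ^+ 2 + c * x) =
  (y - x) * (4 * k * x + c + 2 * k * (y - x)) by ring.
by rewrite mulr_ge0 ?subr_ge0 // addr_ge0 // mulr_ge0 //; lra.
Qed.

Lemma envlow_le j h : (0 < j)%N -> (0 < h)%N ->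
  zq (Cert.envlow (Z.of_nat j) (2 ^ Z.of_nat h.-1)%zz) / Sq <= env j 0 h.
Proof.
move=> j0 h0.
have jq : 0 < j%:R :> rat by rewrite ltr0n.
have Kj : 0 < zq (Cert.K (Z.of_nat j)) by rewrite K_kap; have := kap_gt0 j; lra.
apply: env_ge => // x hx.
rewrite (ler_pdivrMr _ _ Sq_gt0).
rewrite /Cert.envlow; cbv zeta; set c := (2 * Cert.U (Z.of_nat j) * Z.of_nat j - _)%zz; set X := (if _ then _ else _).
apply: div_floor; first by nia.
have n400 : zq 400 = 400 by rewrite (zqS (n := 400)).
have n2 := zqS (erefl : 2%zz = Z.of_nat 2).
have -> : quad j 0%:R x * Sq * zq (400 * Z.of_nat j * Z.of_nat j) = Sq * (400 * j%:R ^+ 2 * quad j 0 x).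
  by rewrite !(zqM, zq_nat) n400; ring.
rewrite zqM -/Sq.
rewrite (quad_scaled x j0).
rewrite -K_kap.
rewrite -U_mu.
apply: (ler_wpM2l (ltW Sq_gt0)).
rewrite 2!zqB !(zqM, zq_nat) n2.
have cE : zq c = 2 * zq (Cert.U (Z.of_nat j)) * j%:R - 3 * zq (Cert.K (Z.of_nat j)) * (j%:R - 1).
  by rewrite /c zqB !(zqM, zqB, zq_nat) n2 (zqS (erefl : 3%zz = Z.of_nat 3)) (zqS (erefl : 1%zz = Z.of_nat 1)).
rewrite -cE; clearbody c.
suff : zq X <= 2 * zq (Cert.K (Z.of_nat j)) * x ^+ 2 + zq c * x.
  by rewrite expr2; lra.
rewrite /X; case: ifP => hc.
  rewrite !(zqD, zqM) !zq_exp2 n2.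
  have h4 : 0 <= 4 * zq (Cert.K (Z.of_nat j)) * 2 ^+ h.-1 + zq c.
    have : zq 0%zz <= zq (4 * Cert.K (Z.of_nat j) * 2 ^ Z.of_nat h.-1 + c)%zz by rewrite zq_le.
    by rewrite zq0 !(zqD, zqM) zq_exp2 (zqS (erefl : 4%zz = Z.of_nat 4)).

  by refine (le_trans _ (quad_right Kj h4 hx)); apply: eq_ler; ring.
apply: le_trans (quad_vertex (zq c) x Kj); rewrite zqN lerN2.
apply: div_up; last first.
  rewrite !zqM (zqS (erefl : 8%zz = Z.of_nat 8)); apply: eq_ler; field; lra.
by apply/Z.ltb_lt; rewrite -zq_lt zq0 zqM (zqS (erefl : 8%zz = Z.of_nat 8)); lra.
Qed.


Lemma eps_ge l : 3/5 <= eps l. Proof. by rewrite /eps; case: (l <= 5)%N; lra. Qed.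
Lemma eps_le l : eps l <= 22/25. Proof. by rewrite /eps; case: (l <= 5)%N; lra. Qed.
Lemma pow2_gt0 n : 0 < 2 ^+ n :> rat. Proof. by rewrite exprn_gt0. Qed.

Lemma weight_ge0 l : 0 <= weight l.
Proof.
by rewrite /weight divr_ge0 //; [have := eps_ge l; lra | have := pow2_gt0 (l - 2); lra].
Qed.

Lemma zq_eps l : zq (Cert.eps l) = eps l * Sq.
Proof.
rewrite /Cert.eps /eps /Sq.
have z5 := zqS (erefl : 5%zz = Z.of_nat 5). have z3 := zqS (erefl : 3%zz = Z.of_nat 3).
have z25 := zqS (erefl : 25%zz = Z.of_nat 25). have z22 := zqS (erefl : 22%zz = Z.of_nat 22).
case: (leqP l 5) => h.
  have -> : (l <=? 5)%N%coq_nat = true by lia.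
  have := etrans (esym (zqM 5%zz 600000%zz)) (zqM 3%zz Cert.S : zq (5 * 600000)%zz = _).
  by rewrite z5 z3; lra.
have -> : (l <=? 5)%N%coq_nat = false by lia.
have := etrans (esym (zqM 25%zz 880000%zz)) (zqM 22%zz Cert.S : zq (25 * 880000)%zz = _).
by rewrite z25 z22; lra.
Qed.

Lemma weight_cert l : weight l * Sq <= zq (Cert.weight l).
Proof.
have p := pow2_gt0 (l - 2).
apply: div_up; first by lia.
rewrite zqD zqM zq_exp2 zq_eps (zqS (erefl : 2%zz = Z.of_nat 2)) (zqS (erefl : 1%zz = Z.of_nat 1)).
by apply: eq_ler; rewrite /weight; field; lra.
Qed.

Lemma zq_sumf (f : nat -> Z) l n : zq (Cert.sumf f l n) = \sum_(l <= i < l + n) zq (f i).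
Proof.
elim: n l => [|n IH] l; first by rewrite addn0 big_geq // zq0.
by rewrite big_ltn; [rewrite zqD IH addSnnS | lia].
Qed.

Lemma inr_cert l j : Cert.inr l (Z.of_nat j) = inrange l j.
Proof.
rewrite /Cert.inr /inrange.
have -> : (2 ^ Z.of_nat (l - 3) = Z.of_nat (2 ^ (l - 3)))%zz by lia.
have -> : (2 ^ Z.of_nat l = Z.of_nat (2 ^ l))%zz by lia.
lia.
Qed.

Lemma sum_prefix_le (F : nat -> rat) (P : pred nat) a n m : (forall l, 0 <= F l) ->
  (forall l, P l -> (l < m)%N) -> (a <= m)%N ->
  \sum_(a <= l < n | P l) F l <= \sum_(a <= l < m | P l) F l.
Proof.
move=> F0 Pm am; have [an|na] := leqP a n; last first.
  by rewrite big_geq ?sumr_ge0 // ltnW.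
have [nm|mn] := leqP n m.
  by rewrite [leRHS](big_cat_nat an nm) /= lerDl sumr_ge0.
rewrite (big_cat_nat am (ltnW mn)) /= gerDl big_nat_cond big1 // => l /andP[/andP[ml _] /Pm]; lia.
Qed.

Lemma tick_cert N j : (j < 128)%N -> tick N j * Sq <= zq (Cert.tick (Z.of_nat j)).
Proof.
move=> j128; apply: le_trans (_ : _ <= (\sum_(5 <= l < 11 | inrange l j) weight l) * Sq) _.
  rewrite ler_pM2r ?Sq_gt0 //; apply: sum_prefix_le => // [l|l]; first exact: weight_ge0.
  move=> /and4P[_ _ le _]; have : (2 ^ (l - 3) < 2 ^ 7)%N by apply: leq_ltn_trans le _.
  by rewrite ltn_exp2l //; lia.
rewrite /Cert.tick zq_sumf mulr_suml [leLHS]big_mkcond /=.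
apply: ler_sum => l _; rewrite inr_cert; case: ifP => _; first exact: weight_cert.
by rewrite zq0.
Qed.

Lemma refresh_cert h : refresh h * Sq <= zq (Cert.refresh h).
Proof.
rewrite /refresh /Cert.refresh zq_sumf mulr_suml.
have [h5|h5] := leqP h 5.
  rewrite big_nat_cond big1; last by move=> l; lia.
  have -> : (h - 5 = 0)%N by lia. by rewrite big_geq ?lexx.
have -> : (5 + (h - 5) = h)%N by lia.
rewrite (@big_cat_nat _ _ _ 5) //=; last by lia.
rewrite big_nat_cond big1 ?add0r; last by move=> l; lia.
rewrite big_mkcond /=; apply: ler_sum_nat => l /andP[l5 _]; rewrite l5.
apply: div_up; first by lia.
rewrite zq_exp2 zq_eps -[(l - 1)%N]/(l - 1)%N subn1.
by apply: eq_ler; field; rewrite expf_neq0.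
Qed.

Lemma log2_trunc j : (0 < j)%N -> Z.log2 (Z.of_nat j) = Z.of_nat (trunc_log 2 j).
Proof.
move=> j0; apply: Z.log2_unique; first by lia.
have /andP[lo hi] := trunc_log_bounds (isT : (1 < 2)%N) j0.
have -> : (2 ^ Z.of_nat (trunc_log 2 j) = Z.of_nat (2 ^ trunc_log 2 j))%zz by lia.
have -> : (2 ^ Z.succ (Z.of_nat (trunc_log 2 j)) = Z.of_nat (2 ^ (trunc_log 2 j).+1))%zz by lia.
lia.
Qed.

Lemma ok_small j h : (0 < h)%N -> (0 < j < 128)%N ->
  (h <= if j < 16 then j else trunc_log 2 j + 3)%N -> Cert.ok j h = true.
Proof.
move=> h0 /andP[j0 j1] hh; have := Cert.all_okP; rewrite /Cert.all_ok.
move=> /List.forallb_forall /(_ j) H.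
have /List.forallb_forall /(_ h) : List.forallb (Cert.ok j) (List.seq 1 (Cert.hmax j)) = true.
  by apply: H; apply/List.in_seq; lia.
apply; apply/List.in_seq; rewrite /Cert.hmax log2_trunc // Nat2Z.id.
case: (ltnP j 16) hh => hj hh.
  have -> : (j <? 16)%N%coq_nat = true by lia. lia.
have -> : (j <? 16)%N%coq_nat = false by lia. lia.
Qed.


Definition certified N j h :=
  exists m, majorant j h m /\ request_ok N j h (crowd_sum j h m).

Lemma ok_certified N j h : (0 < h)%N -> (0 < j < 128)%N -> Cert.ok j h = true -> certified N j h.
Proof.
move=> h0 /andP[j0 j128] ok.
pose A := (2 ^ (h - 2))%N.
exists (fun i => zq (Cert.m (Z.of_nat A) (Z.of_nat i)) / Sq); split.
  split=> [i|i J /andP[ji _] iJ].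
    by rewrite divr_ge0 ?(ltW Sq_gt0) // -zq0 zq_le; have := @Cert_m_ge0 (Z.of_nat A) (Z.of_nat i); lia.
  rewrite (_ : 2 ^+ (h - 2) = A%:R); last by rewrite natrX.
  by apply: rise_m; lia.
move: ok; rewrite /Cert.ok; cbv zeta.
set Bz := Cert.msum _ _ _; set Gz := (_ + Cert.tick _)%zz.
have BE : crowd_sum j h (fun i => zq (Cert.m (Z.of_nat A) (Z.of_nat i)) / Sq) * Sq = zq Bz.
  rewrite /crowd_sum -mulr_suml divfK ?gt_eqF ?Sq_gt0 //.
  rewrite /Bz; have -> : (Z.of_nat j + 1 = Z.of_nat j.+1)%zz by lia.
  have -> : (2 ^ Z.of_nat (h - 2) = Z.of_nat A)%zz by rewrite /A; lia.
  by rewrite zq_msum; congr (\sum_(_ <= i < _) _); rewrite /crowd; lia.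
rewrite /request_ok; set B := crowd_sum _ _ _ in BE *.
have GE : (h%:R - (trunc_log 2 j).+2%:R + B - env j 0 h + tick N j) * Sq <= zq Gz.
  have e := envlow_le j0 h0; rewrite (ler_pdivrMr _ _ Sq_gt0) in e.
  have t := tick_cert N j128.
  rewrite /Gz zqD zqB zqD zqM -BE !zqB zq_nat log2_trunc // zq_nat -/Sq.
  rewrite (zqS (erefl : 2%zz = Z.of_nat 2)).
  have -> : (h - 1 = h.-1)%N by lia.
  rewrite (_ : (trunc_log 2 j).+2%:R = (trunc_log 2 j)%:R + 2 :> rat); last by rewrite -natrD addn2.
  lra.
clearbody Gz Bz; have S0 := Sq_gt0; have rf := refresh_cert h; have ep := zq_eps h.
rewrite inr_cert.
have -> : (h <? 5)%N%coq_nat = (h < 5)%N by lia.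
have le0 (x : rat) (z : Z) : x * Sq <= zq z -> (z <=? 0)%zz -> x <= 0.
  by rewrite -zq_le zq0 -(pmulr_lle0 x S0) => /le_trans h1 /h1.
case: (h < 5)%N; first by move=> ok; exact: (le0 _ _ GE ok).
case: (inrange h j) => ok.
  rewrite -(ler_pM2r S0) -ep; rewrite -[_ = true]/(is_true _) -zq_le zqD in ok.
  by apply: le_trans ok; rewrite mulrDl lerD.
refine (le0 _ _ _ ok); rewrite 2!zqD ep 2!mulrDl.
by apply: lerD (lexx _); apply: lerD GE rf.
Qed.

Lemma small_certified N j h : (0 < h <= j)%N -> (j < 128)%N ->
  ((j < 16) || (h <= trunc_log 2 j + 3))%N -> certified N j h.
Proof.
move=> /andP[h0 hj] j128 c; apply: ok_certified => //; first by lia.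
by apply: ok_small => //; [lia | case: ltnP c => //; lia].
Qed.

(** * Uniform bounds on the antipodal charges *)

Lemma weight_sum_le a n : (5 <= a)%N -> \sum_(a <= l < n) weight l <= 176/25 / 2 ^+ a.-1.
Proof.
(* Geometric tail: [weight l <= 176/25 / 2 ^ l], written in telescoped form. *)
move=> a5; suff le k : \sum_(a <= l < a + k) weight l <= 176/25 / 2 ^+ a.-1 - 176/25 / 2 ^+ (a + k).-1.
  have [an|na] := leqP a n; last first.
    rewrite big_geq; last exact: ltnW.
    by apply: divr_ge0; [lra | apply: ltW; exact: pow2_gt0].
  rewrite -(subnKC an); apply: le_trans (le _) _.
  have : 0 < (2 ^+ (a + (n - a)).-1)^-1 :> rat by rewrite invr_gt0 pow2_gt0.
  lra.
elim: k => [|k IH]; first by rewrite addn0 (big_geq (leqnn _)) subrr lexx.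
rewrite addnS big_nat_recr /=; last by lia.
apply: le_trans (lerD IH (_ : _ <= 176/25 / 2 ^+ (a + k))) _; last first.
  have -> : 2 ^+ (a + k) = 2 * 2 ^+ (a + k).-1 :> rat.
    by rewrite -exprS; congr (_ ^+ _); lia.
  by apply: eq_ler; field; rewrite !gt_eqF ?pow2_gt0.
have p := pow2_gt0 (a + k - 2).
have E : 2 ^+ (a + k) = 4 * 2 ^+ (a + k - 2) :> rat.
  have -> : 4 = 2 ^+ 2 :> rat by lra.
  by rewrite -exprD; congr (_ ^+ _); lia.
rewrite /weight E; apply: frac_le; [lra | lra |].
have : eps (a + k) * 2 ^+ (a + k - 2) <= 22/25 * 2 ^+ (a + k - 2).
  by rewrite (ler_pM2r p); exact: eps_le.
lra.
Qed.

Lemma tick_le N j : tick N j <= 11/25.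
Proof.
apply: le_trans (_ : _ <= \sum_(5 <= l < N.+1) weight l) _.
  by rewrite /tick big_mkcond; apply: ler_sum => l _; case: ifP => // _; exact: weight_ge0.
by apply: le_trans (weight_sum_le _ _) _; first exact: leqnn; lra.
Qed.

(** For [j >= 128] a height in range is at least 8, which leaves only the tail of the weights. *)
Lemma tick_large N j : (128 <= j)%N -> tick N j <= 11/200.
Proof.
move=> hj; apply: le_trans (_ : _ <= \sum_(8 <= l < N.+1) weight l) _; last first.
  by apply: le_trans (weight_sum_le _ _) _; first by []; lra.
rewrite /tick.
have [N8|N8] := leqP N.+1 8.
  rewrite [leRHS]big_geq // big_nat_cond big1 // => l /andP[/andP[_ l8] /and4P[_ _ _ jl]].
  have : (2 ^ l <= 2 ^ 7)%N by rewrite leq_exp2l //; lia.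
  by have : (2 ^ 7 = 128)%N by []; lia.
rewrite (@big_cat_nat _ _ _ 8) //=; last exact: ltnW.
rewrite big_nat_cond big1 ?add0r; last first.
  move=> l /andP[/andP[_ l8] /and4P[_ _ _ jl]].
  have : (2 ^ l <= 2 ^ 7)%N by rewrite leq_exp2l //; lia.
  by have : (2 ^ 7 = 128)%N by []; lia.
by rewrite big_mkcond; apply: ler_sum => l _; case: ifP => // _; exact: weight_ge0.
Qed.

Lemma refresh_le h : refresh h <= 37/400.
Proof.
rewrite /refresh.
have F0 l : 0 <= eps l / 2 ^+ l.-1.
  by apply: divr_ge0; [have := eps_ge l; lra | apply: ltW; exact: pow2_gt0].
apply: le_trans (_ : _ <= \sum_(5 <= l < maxn h 6) eps l / 2 ^+ l.-1) _.
  have [h5|h5] := leqP h 5.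
    rewrite big_nat_cond big1; last by move=> l; lia.
    by apply: sumr_ge0.
  rewrite (@big_cat_nat _ _ _ 5) //=; last by lia.
  rewrite big_nat_cond big1 ?add0r; last by move=> l; lia.
  have -> : maxn h 6 = h by lia.
  by rewrite big_mkcond; apply: ler_sum => l _; case: ifP.
rewrite big_ltn; last by lia.
have -> : maxn h 6 = (6 + (maxn h 6 - 6))%N by lia.
suff le k : \sum_(6 <= l < 6 + k) eps l / 2 ^+ l.-1 <= 11/200 - 22/25 / 2 ^+ (4 + k).
  apply: le_trans (lerD (lexx _) (le _)) _; rewrite /eps.
  have : 0 < (2 ^+ (4 + (maxn h 6 - 6)))^-1 :> rat by rewrite invr_gt0 pow2_gt0.
  by rewrite /=; lra.
elim: k => [|k IH]; first by rewrite addn0 (big_geq (leqnn _)) /=; lra.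
rewrite addnS big_nat_recr; last exact: leq_addr.
apply: le_trans (lerD IH (_ : _ <= 22/25 / 2 ^+ (4 + k).+1)) _.
  rewrite (_ : (6 + k).-1 = (4 + k).+1)%N; last by lia.
  have pV : 0 < (2 ^+ (4 + k).+1)^-1 :> rat by rewrite invr_gt0 pow2_gt0.
  by rewrite (ler_pM2r pV); exact: eps_le.
apply: eq_ler; rewrite addnS exprS; have := pow2_gt0 (4 + k); move: (2 ^+ (4 + k)) => p p0.
by field; rewrite gt_eqF.
Qed.


(** * Ranks beyond the table *)

Module Block.
Local Open Scope Z_scope.
(** [-500000] is the bound of [env_ge_half]. Otherwise [d] is the upper end of the block of [j], and
    [100] absorbs the lower-order terms through [parabola_shift]. *)
Definition elow (r : nat) (j : Z) :=
  if (r =? 1)%nat then -500000 else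
  let H := 2 ^ Z.of_nat (6 + r) in let d := j + 1 in
  Cert.S * (7 * H * (2 * H - 3 * d)) / (16 * d * d) - 100.
(** [147500] is [11/200 + 37/400], the bounds on [tick] and [refresh], and [880000] is [22/25], all
    scaled. *)
Definition ok (r j : nat) :=
  (Z.of_nat r - 2) * Cert.S + Cert.msum (2 ^ Z.of_nat (5 + r)) (Z.of_nat j) (2 ^ (6 + r) + 1)
   - elow r (Z.of_nat j) + 147500 <=? 880000.
Definition all_ok := List.forallb (fun r => List.forallb (ok r) (List.seq 128 128)) (List.seq 1 3).
Lemma all_okP : all_ok = true.
Proof. vm_compute. reflexivity. Qed.
End Block.

Lemma block_ok r j : (0 < r < 4)%N -> (128 <= j < 256)%N -> Block.ok r j = true.
Proof.
move=> hr hj; have := Block.all_okP; rewrite /Block.all_ok => /List.forallb_forall /(_ r) H.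
have /List.forallb_forall : List.forallb (Block.ok r) (List.seq 128 128) = true.
  by apply: H; apply/List.in_seq; lia.
by apply; apply/List.in_seq; lia.
Qed.

Lemma sum_blocks (R : numDomainType) (f : nat -> R) (lam a n : nat) : (0 < lam)%N ->
  \sum_(lam * a <= i < lam * (a + n)) f (i %/ lam)%N = lam%:R * \sum_(a <= i < a + n) f i.
Proof.
move=> lam0; elim: n => [|n IH]; first by rewrite addn0 !big_geq // mulr0.
rewrite addnS big_nat_recr /=; last exact: leq_addr.
rewrite mulrDr -IH (@big_cat_nat _ _ _ (lam * (a + n))) /=; [|nia..].
congr (_ + _); rewrite big_nat_cond (eq_bigr (fun=> f (a + n)%N)); last first.
  move=> i /andP[/andP[lo hi] _]; congr f; apply/eqP; rewrite eqn_leq.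
  by rewrite leq_divRL // mulnC lo -ltnS ltn_divLR // mulnC hi.
rewrite -big_nat_cond sumr_const_nat mulr_natl; congr (_ *+ _); nia.
Qed.

Lemma sum_subrange (R : numDomainType) (f : nat -> R) a b c d : (forall i, 0 <= f i) ->
  (c <= a)%N -> (b <= d)%N -> \sum_(a <= i < b) f i <= \sum_(c <= i < d) f i.
Proof.
move=> f0 ca bd; have [ba|ab] := leqP b a; first by rewrite big_geq // sumr_ge0.
rewrite [leRHS](@big_cat_nat _ _ _ a) //=; last by lia.
rewrite [X in _ <= _ + X](@big_cat_nat _ _ _ b) //=; last by lia.
by rewrite addrCA lerDl addr_ge0 // sumr_ge0.
Qed.

Lemma quad_large J x : (16 <= J)%N ->
  quad J 0%:R x = 7/8 * (x ^+ 2 - 3/2 * (J%:R - 1) * x - 1) / J%:R ^+ 2.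
Proof.
move=> J16; rewrite /quad (kap_large J16) (mu_large J16); field.
by rewrite pnatr_eq0; lia.
Qed.

(** The vertex [x = 3/4 (j - 1)] gives a value near [-63/128]. *)
Lemma env_ge_half j h : (16 <= j)%N -> (0 < h)%N -> - (1/2) <= env j 0 h.
Proof.
move=> j16 h0; apply: env_ge; [lia | exact: h0 |].
move=> x _; rewrite (quad_large x j16).
have : 16 <= j%:R :> rat by rewrite ler_nat.
move: (j%:R) => y y16; have y2 : 0 < y ^+ 2 by apply: exprn_gt0; lra.
rewrite (ler_pdivlMr _ _ y2).
have := sqr_ge0 (x - 3/4 * (y - 1)).
have : 0 <= (y - 16) * (y + 16) by apply: mulr_ge0; lra.
rewrite !expr2; nra.
Qed.

Lemma env_ge_quad j h (H : rat) : (16 <= j)%N -> (0 < h)%N -> H = 2 ^+ h.-1 -> j%:R <= H ->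
  7/8 * (H ^+ 2 - 3/2 * (j%:R - 1) * H - 1) / j%:R ^+ 2 <= env j 0 h.
Proof.
move=> j16 h0 HE jH; apply: env_ge; [lia | exact: h0 |].
move=> x; rewrite -HE (quad_large x j16).
have : 16 <= j%:R :> rat by rewrite ler_nat.
move: (j%:R) jH => y yH y16 hx.
have y2 : 0 < (y ^+ 2)^-1 by rewrite invr_gt0; apply: exprn_gt0; lra.
rewrite (ler_pM2r y2).
have : 0 <= (x - H) * (x + H - 3/2 * (y - 1)) by apply: mulr_ge0; lra.
rewrite !expr2; nra.
Qed.

Lemma rise_large J i (a : rat) : (16 <= J)%N ->
  rise J (J%:R - i%:R) a = 7/16 * (3 * J%:R - (6 * i%:R - 6 * a - 3)) / J%:R ^+ 2.
Proof.
by move=> J16; rewrite /rise (kap_large J16) (mu_large J16); field; rewrite pnatr_eq0; lia.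
Qed.


Lemma crowd_lt j h : (2 <= h)%N -> (crowd j h < 2 * 2 ^ (h - 2))%N.
Proof.
move=> h2; rewrite /crowd -expnS; have -> : ((h - 2).+1 = h.-1)%N by lia.
have := expn_gt0 2 h.-1; lia.
Qed.

(** Here [6 i - 6 A - 3 >= 9/2 j], so the peak value [63 / (64 x)] is at most [7/32 / j]. *)
Lemma rise_low (R : realFieldType) (j i A J : R) : 16 <= j -> 4 * A <= j -> j + 1 <= i -> i <= J ->
  7/16 * (3 * J - (6 * i - 6 * A - 3)) / J ^+ 2 <= (11/50) / j.
Proof.
move=> j16 Aj ji iJ.
have i0 : 0 < i by lra.
apply: le_trans (quad_sup i0 iJ (lexx _)) _.
have -> : (2 * (6 * i - 6 * A - 3) <= 3 * i) = false by apply/negbTE; rewrite -ltNge; lra.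
by apply: frac_le; lra.
Qed.

(** At these heights [crowd] is at most [j / 2], so the loss stays below [11/100], while
    [h - (trunc_log 2 j + 2)] leaves a slack of 2. *)
Lemma certified_low N j h : (128 <= j)%N -> (0 < h <= trunc_log 2 j)%N -> certified N j h.
Proof.
move=> j128 /andP[h0 hF]; have j16 : (16 <= j)%N by lia.
set F := trunc_log 2 j in hF *.
have F7 : (7 <= F)%N by apply: trunc_log_max.
have pF : (2 ^ F <= j)%N by apply: trunc_logP; lia.
have cr : (2 * crowd j h <= j)%N.
  have [h2|h1] := leqP 2 h.
    have := crowd_lt j h2; have : (4 * 2 ^ (h - 2) <= 2 ^ F)%N; last by lia.
    by clear -hF F7; rewrite -[4%N]/(2 ^ 2)%N -expnD leq_exp2l; [lia | by []].
  have -> : h = 1%N by lia.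
  by rewrite /crowd.
have jq : 128 <= j%:R :> rat by rewrite ler_nat.
have jV : 0 < j%:R^-1 :> rat by rewrite invr_gt0; lra.
have A4 : (4 * 2 ^ (h - 2) <= j)%N.
  apply: leq_trans pF; clear -hF F7; rewrite -[4%N]/(2 ^ 2)%N -expnD leq_exp2l; [lia | by []].
have A4q : 4 * 2 ^+ (h - 2) <= j%:R :> rat by rewrite -natrX -natrM ler_nat.
exists (fun=> 11/50 / j%:R); split.
  split=> [_|i J /andP[ji _] iJ]; first by apply: mulr_ge0; lra.
  have J16 : (16 <= J)%N by lia.
  rewrite (rise_large _ _ J16); apply: rise_low; [lra | exact: A4q | by rewrite natr1 ler_nat | by rewrite ler_nat].
have B : crowd_sum j h (fun=> 11/50 / j%:R) <= 11/100.
  rewrite /crowd_sum sumr_const_nat -[leLHS]mulr_natr.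
  have leq : 2 * (crowd j h)%:R <= j%:R :> rat by rewrite -natrM ler_nat.
  rewrite subSS addKn.
  have j0q : 0 < j%:R :> rat by lra.
  have : (crowd j h)%:R / j%:R <= 1/2 :> rat by rewrite (ler_pdivrMr _ _ j0q); lra.
  move=> k; have -> : 11/50 / j%:R * (crowd j h)%:R = 11/50 * ((crowd j h)%:R / j%:R) :> rat by rewrite -mulrA [j%:R^-1 * _]mulrC.
  lra.
rewrite /request_ok -/F.
have e := env_ge_half j16 h0; have t := tick_large N j128; have r := refresh_le h.
have ep := eps_le h; have ep' := eps_ge h.
have hq : h%:R <= F%:R :> rat by rewrite ler_nat.
have -> : F.+2%:R = F%:R + 2 :> rat by rewrite -natrD addn2.
case: (h < 5)%N; first by lra.
by case: (inrange h j); lra.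
Qed.

Lemma rise_high (R : realFieldType) (i A J : R) : 1 < i -> 0 <= A -> i <= 4 * A + 2 -> i <= J ->
  7/16 * (3 * J - (6 * i - 6 * A - 3)) / J ^+ 2 <= 21/8 * (A + 1/2) / (i * (i - 1)).
Proof.
move=> i1 A0 iA iJ.
apply: le_trans (_ : _ <= 21/8 * (A + 1/2) / i ^+ 2) _.
  have i2 : 0 < i ^+ 2 by apply: exprn_gt0; lra.
  have J2 : 0 < J ^+ 2 by apply: exprn_gt0; lra.
  apply: frac_le => //; rewrite -subr_ge0.
  have -> : 21/8 * (A + 1/2) * J ^+ 2 - 7/16 * (3 * J - (6 * i - 6 * A - 3)) * i ^+ 2 =
    21/16 * ((J - i) * ((4 * A + 2 - i) * i + (2 * A + 1) * (J - i)) + i ^+ 3) by field.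
  apply: mulr_ge0; first lra.
  apply: addr_ge0; last by apply: exprn_ge0; lra.
  apply: mulr_ge0; first lra.
  by apply: addr_ge0; apply: mulr_ge0; lra.
have i2 : 0 < i ^+ 2 by apply: exprn_gt0; lra.
apply: frac_le => //; first by apply: mulr_gt0; lra.
by rewrite expr2; apply: ler_wpM2l; [lra | apply: ler_wpM2l; lra].
Qed.

Lemma sum_consecutive_inv (R : numFieldType) j n : (0 < j)%N ->
  \sum_(j.+1 <= i < (j + n).+1) ((i%:R * (i%:R - 1))^-1 : R) = j%:R^-1 - (j + n)%:R^-1.
Proof.
move=> j0; elim: n => [|n IH]; first by rewrite addn0 big_geq // subrr.
rewrite addnS big_nat_recr /=; last by lia.
rewrite IH -natr1 addrK.
have : (j + n)%:R != 0 :> R by rewrite pnatr_eq0; lia.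
have : (j + n)%:R + 1 != 0 :> R by rewrite natr1 pnatr_eq0.
have : j%:R != 0 :> R by rewrite pnatr_eq0; lia.
move: (j + n)%:R j%:R => x y y0 x1 x0.
by field; rewrite x0 x1 y0.
Qed.

Lemma high_bound (R : realFieldType) (j A r : R) : 16 <= j -> 4 * j <= 2 * A -> (r + 1) * j <= 2 * A ->
  21/8 * (A + 1/2) / j - 7/8 * ((2 * A) ^+ 2 - 3/2 * (j - 1) * (2 * A) - 1) / j ^+ 2 <= - (7/2) * (r - 2).
Proof.
move=> j16 h4 hr.
have -> : 21/8 * (A + 1/2) / j - 7/8 * ((2 * A) ^+ 2 - 3/2 * (j - 1) * (2 * A) - 1) / j ^+ 2 =
  7/8 * (3 * (2 * A) * j - (2 * A) ^+ 2 + 3/2 * j - 3 * A + 1) / j ^+ 2 by field; lra.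
have j2 : 0 < j ^+ 2 by apply: exprn_gt0; lra.
rewrite ler_pdivrMr // !expr2.
(* Gives [(2A)^2 >= 7 j (2A) - 12 j^2], so the square in the envelope outweighs the crowd term. *)
have p1 : 0 <= (2 * A - 3 * j) * (2 * A - 4 * j) by apply: mulr_ge0; lra.
have p2 : 0 <= j * (2 * A - (r + 1) * j) by apply: mulr_ge0; lra.
lra.
Qed.

Lemma certified_high N j h : (16 <= j)%N -> (trunc_log 2 j + 4 <= h)%N -> certified N j h.
Proof.
move=> j16 hF; set F := trunc_log 2 j in hF *.
have h0 : (0 < h)%N by lia.
pose A : rat := 2 ^+ (h - 2).
have HE : 2 * A = 2 ^+ h.-1 by rewrite /A -exprS; congr (_ ^+ _); lia.
have jF : (j < 2 ^ F.+1)%N by apply: trunc_log_ltn.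
pose r := (h - F.+1)%N.
have r3 : (3 <= r)%N by rewrite /r; lia.
(* This needs [r >= 3], hence the threshold [trunc_log 2 j + 4]. *)
have pr : (r.+1 <= 2 ^ r.-1)%N.
  have : forall k, (k + 4 <= 2 ^ (k + 2))%N by elim=> // k IH; rewrite !addSn expnS; lia.
  move=> /(_ (r - 3)%N); have -> : (r - 3 + 2 = r.-1)%N by lia.
  by clear -r3; lia.
have E : (2 ^ h.-1 = 2 ^ r.-1 * 2 ^ F.+1)%N by rewrite -expnD; congr (_ ^ _)%N; rewrite /r; lia.
have hrF : h = (r + F + 1)%N by rewrite /r; clear -hF; lia.
have F4 : (4 <= F)%N by apply: trunc_log_max.
have h5 : (h < 5)%N = false by clear -hF F4; lia.
have ninr : inrange h j = false.
  apply/negbTE/and4P => -[_ _ le _].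
  have : (2 ^ F.+1 <= 2 ^ (h - 3))%N by rewrite leq_exp2l //; clear -hF; lia.
  by rewrite leqNgt (leq_ltn_trans le jF).
have j16q : 16 <= j%:R :> rat by rewrite ler_nat.
have hr : (r%:R + 1) * j%:R <= 2 * A.
  by rewrite HE natr1 -natrX -natrM ler_nat E leq_mul // ltnW.
have h4 : 4 * j%:R <= 2 * A.
  apply: le_trans hr; rewrite natr1 -!natrM ler_nat leq_mul2r; lia.
have A0 : 0 <= A by lra.
(* Chosen to telescope: its sum over the ranks above [j] is at most [21/8 (A + 1/2) / j]. *)
pose m i : rat := 21/8 * (A + 1/2) / (i%:R * (i%:R - 1)).
exists m; split.
  split=> [i|i J /andP[ji ij] iJ].
    apply: mulr_ge0; first by apply: mulr_ge0; lra.
    rewrite invr_ge0; case: i => [|i]; first by rewrite mul0r lexx.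
    by apply: mulr_ge0; rewrite -?natr1 ?addrK ?ler0n // natr1 ler0n.
  have J16 : (16 <= J)%N by lia.
  rewrite (rise_large _ _ J16); apply: rise_high; [by rewrite ltr1n; lia | exact: A0 | | by rewrite ler_nat].
  apply: le_trans (_ : _ <= (j + 2 * 2 ^ (h - 2))%:R) _.
    by rewrite ler_nat; have := @crowd_lt j h; lia.
  by rewrite natrD natrM natrX -/A; lra.
have B : crowd_sum j h m <= 21/8 * (A + 1/2) / j%:R.
  rewrite /crowd_sum /m -mulr_sumr.
  have c0 : 0 <= 21/8 * (A + 1/2) by apply: mulr_ge0; lra.
  apply: (ler_wpM2l c0); rewrite sum_consecutive_inv; last by lia.
  by rewrite gerBl invr_ge0 ler0n.
rewrite /request_ok -/F.
have jA : j%:R <= 2 * A by lra.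
have e := env_ge_quad j16 h0 HE jA; have t := tick_le N j; have rf := refresh_le h.
have hb := high_bound j16q h4 hr.
have ep := eps_le h.
have hq : h%:R = r%:R + F%:R + 1 :> rat by rewrite -natrD natr1 addn1 in hrF *; rewrite -hrF.
have F2 : F.+2%:R = F%:R + 2 :> rat by rewrite -natrD addn2.
have r3q : 3 <= r%:R :> rat by rewrite ler_nat.
rewrite h5 ninr hq F2.
move: (crowd_sum j h m) B => B Bl.
clearbody A F r.
move: (env j 0 h) e => E' e.
lra.
Qed.


Lemma parabola_mono (R : realFieldType) (j H H0 d lam : R) : 0 < lam -> 0 < d -> 0 < j ->
  H = lam * H0 -> j <= lam * d -> d <= H0 ->
  7 * H0 * (2 * H0 - 3 * d) / (16 * d * d) <= 7/8 * (H ^+ 2 - 3/2 * j * H) / j ^+ 2.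
Proof.
move=> l0 d0 j0 HE jd dH.
have dd : 0 < 16 * d * d by rewrite !mulr_gt0.
have jj : 0 < j ^+ 2 by apply: exprn_gt0.
apply: frac_le => //; rewrite -subr_ge0.
have -> : 7/8 * (H ^+ 2 - 3/2 * j * H) * (16 * d * d) - 7 * H0 * (2 * H0 - 3 * d) * j ^+ 2 =
  14 * ((H * d - H0 * j) * (H * d + H0 * j - 3/2 * (j * d))) by field.
have p1 : 0 <= H * d - H0 * j.
  rewrite HE; have -> : lam * H0 * d - H0 * j = H0 * (lam * d - j) by ring.
  by apply: mulr_ge0; lra.
have p2 : 0 <= j * (H0 - d) by apply: mulr_ge0; lra.
have jd0 : 0 < j * d by apply: mulr_gt0.
apply: mulr_ge0; first lra.
apply: mulr_ge0 => //; lra.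
Qed.

Lemma parabola_shift (R : realFieldType) (j H : R) : 128 <= j -> 0 < H ->
  7/8 * (H ^+ 2 - 3/2 * j * H) / j ^+ 2 - 1/(100 * 100) <=
  7/8 * (H ^+ 2 - 3/2 * (j - 1) * H - 1) / j ^+ 2.
Proof.
move=> j128 H0; have j2 : 0 < j ^+ 2 by apply: exprn_gt0; lra.
rewrite (ler_pdivlMr _ _ j2) mulrBl divfK ?gt_eqF //.
have : 0 <= (j - 128) * (j + 128) by apply: mulr_ge0; lra.
by rewrite !expr2; lra.
Qed.

Lemma elow_le j h r (lam j0 : nat) : (0 < r < 4)%N -> (128 <= j0 < 256)%N -> (0 < lam)%N ->
  (lam * j0 <= j < lam * j0.+1)%N -> (2 ^ h.-1 = lam * 2 ^ (6 + r))%N -> (0 < h)%N ->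
  zq (Block.elow r (Z.of_nat j0)) / Sq <= env j 0 h.
Proof.
move=> hr hj l0 hl hH h0.
have j128 : (128 <= j)%N by nia.
have j16 : (16 <= j)%N by lia.
have S0 := Sq_gt0; rewrite (ler_pdivrMr _ _ S0) /Block.elow.
have zS : zq (-500000)%zz * 2 = - Sq.
  have := etrans (esym (zqM 2%zz (-500000)%zz)) (zqN Cert.S : zq (2 * -500000)%zz = _).
  by rewrite (zqS (erefl : 2%zz = Z.of_nat 2)) mulrC.
have z100 : zq 100%zz * (100 * 100) = Sq.
  have z := zqS (erefl : 100%zz = Z.of_nat 100).
  have E : zq 100%zz * (zq 100%zz * zq 100%zz) = Sq.
    exact: (etrans (congr1 _ (esym (zqM 100%zz 100%zz))) (esym (zqM 100%zz (100 * 100)%zz))).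
  rewrite z in E; rewrite z; exact: E.
case: (Nat.eqb_spec r 1) => r1.
  have e := env_ge_half j16 h0.
  have p : 0 <= (env j 0 h + 1/2) * Sq by apply: mulr_ge0; [lra | exact: ltW].
  by lra.
have r2 : (2 <= r)%N by lia.
have H0j : (j0.+1 <= 2 ^ (6 + r))%N.
  by apply: leq_trans (_ : _ <= 2 ^ 8)%N _; [lia | rewrite leq_exp2l //; lia].
have jH : (j <= 2 ^ h.-1)%N by rewrite hH; apply: leq_trans (leq_mul (leqnn lam) H0j); lia.
have hl2 : (j <= lam * j0.+1)%N by lia.
cbv zeta; rewrite zqB.
have d1 : (Z.of_nat j0 + 1 = Z.of_nat j0.+1)%zz by lia.
rewrite d1; clear hl hj d1.
have jq : 128 <= j%:R :> rat by rewrite ler_nat.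
have jHq : j%:R <= 2 ^+ h.-1 :> rat by rewrite -natrX ler_nat.
have e := env_ge_quad j16 h0 (erefl _) jHq.
pose d : rat := j0.+1%:R; pose H0 : rat := 2 ^+ (6 + r); pose H : rat := 2 ^+ h.-1.
have dH : d <= H0 by rewrite /H0 -natrX ler_nat.
have HE : H = lam%:R * H0 by rewrite /H /H0 -!natrX -natrM hH.
have jd : j%:R <= lam%:R * d by rewrite -natrM ler_nat.
have d0 : 0 < d by rewrite ltr0n.
have lq : 0 < lam%:R :> rat by rewrite ltr0n.
have j0q : 0 < j%:R :> rat by lra.
have P := parabola_mono lq d0 j0q HE jd dH.
have dE : j0.+1%:R = d by [].
have H0E : 2 ^+ (6 + r) = H0 by [].
clearbody d H0.
have D : zq (Cert.S * (7 * 2 ^ Z.of_nat (6 + r) * (2 * 2 ^ Z.of_nat (6 + r) - 3 * Z.of_nat j0.+1)) /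
    (16 * Z.of_nat j0.+1 * Z.of_nat j0.+1))%zz <=
    Sq * (7 * H0 * (2 * H0 - 3 * d) / (16 * d * d)).
  apply: div_floor; first by clear; lia.
  rewrite !(zqB, zqM, zq_nat, zq_exp2) H0E dE -/Sq.
  rewrite (zqS (erefl : 2%zz = Z.of_nat 2)) (zqS (erefl : 3%zz = Z.of_nat 3)).
  rewrite (zqS (erefl : 7%zz = Z.of_nat 7)) (zqS (erefl : 16%zz = Z.of_nat 16)).
  by apply: eq_ler; field; apply: lt0r_neq0.
have T : 7/8 * (H ^+ 2 - 3/2 * j%:R * H) / j%:R ^+ 2 - 1/(100 * 100) <= env j 0 h.
  apply: le_trans e; rewrite -/H.
  by apply: parabola_shift; [exact: jq | apply: lt_le_trans jHq].
have : 0 <= Sq * (env j 0 h + 1/(100 * 100) - 7 * H0 * (2 * H0 - 3 * d) / (16 * d * d)).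
  by apply: mulr_ge0; [exact: ltW | lra].
lra.
Qed.

(** Dividing by [lam] brings [j] into [128, ..., 255]. Rounding the ranks down only weakens the
    bound on [rise], so the finite table of [Block] covers every large [j]. *)
Lemma certified_mid N j h : (128 <= j)%N -> (trunc_log 2 j < h <= trunc_log 2 j + 3)%N ->
  certified N j h.
Proof.
move=> j128 hF; set F := trunc_log 2 j in hF *.
have F7 : (7 <= F)%N by apply: trunc_log_max.
have pF : (2 ^ F <= j)%N by apply: trunc_logP; lia.
have jF : (j < 2 ^ F.+1)%N by apply: trunc_log_ltn.
pose r := (h - F)%N; pose lam := (2 ^ (F - 7))%N; pose j0 := (j %/ lam)%N.
pose A0 := (2 ^ (5 + r))%N.
have l0 : (0 < lam)%N by rewrite expn_gt0.
have hr : (0 < r < 4)%N by rewrite /r; lia.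
have hA : (2 ^ (h - 2) = lam * A0)%N by rewrite -expnD; congr (2 ^ _)%N; rewrite /r; lia.
have hH : (2 ^ h.-1 = lam * 2 ^ (6 + r))%N by rewrite -expnD; congr (2 ^ _)%N; rewrite /r; lia.
have hj : (128 <= j0 < 256)%N.
  rewrite leq_divRL // ltn_divLR // -[128%N]/(2 ^ 7)%N -[256%N]/(2 ^ 8)%N -!expnD.
  have -> : (7 + (F - 7) = F)%N by lia.
  have -> : (8 + (F - 7) = F.+1)%N by lia.
  by rewrite pF jF.
have hl : (lam * j0 <= j < lam * j0.+1)%N.
  by rewrite [(lam * j0)%N]mulnC leq_trunc_div /= mulnC -ltn_divLR.
have h0 : (0 < h)%N by lia.
have h2 : (2 <= h)%N by lia.
have F2 : (F.+2 + r = h + 2)%N by rewrite /r; lia.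
(* One block beyond [2 * A0], since [j] need not be the start of its block. *)
have cr : (j + crowd j h < lam * (j0 + (2 * A0).+1))%N.
  have := crowd_lt j h2; rewrite hA; move: hl; rewrite mulnS mulnDr mulnS; nia.
have i0 i : (j < i)%N -> (128 <= i %/ lam)%N.
  by move=> ji; apply: leq_trans (leq_div2r _ (ltnW ji)); case/andP: hj.
pose f i0 : rat := zq (Cert.m (Z.of_nat A0) (Z.of_nat i0)) / Sq.
have S0 := Sq_gt0.
have f0 i : 0 <= f i.
  by apply: divr_ge0; [rewrite -zq0 zq_le; have := @Cert_m_ge0 (Z.of_nat A0) (Z.of_nat i); lia | exact: ltW].
have lq : 0 < lam%:R :> rat by rewrite ltr0n.
exists (fun i => f (i %/ lam)%N / lam%:R); split.
  split=> [i|i J /andP[ji _] iJ]; first by apply: divr_ge0; [exact: f0 | exact: ltW].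
  have -> : 2 ^+ (h - 2) = (lam * A0)%:R :> rat by rewrite -hA natrX.
  have J16 : (16 <= J)%N by clear -ji iJ j128; lia.
  have i128 := i0 _ ji.
  have t1 : (lam * maxn (i %/ lam) 16 <= J)%N.
    have -> : maxn (i %/ lam) 16 = (i %/ lam)%N by clear -i128; lia.
    by rewrite mulnC; apply: leq_trans (leq_trunc_div _ _) iJ.
  have t2 : (lam * (i %/ lam) <= i)%N by rewrite mulnC leq_trunc_div.
  have t3 : 1 <= lam%:R :> rat by rewrite ler1n.
  have le : Sq * rise J (J%:R - i%:R) (lam * A0)%:R <=
      zq (Cert.big (Z.of_nat A0) (Z.of_nat (i %/ lam))) / lam%:R.
    apply: (rise_big J16 lq); first by rewrite -natrM ler_nat.
    have t2q : lam%:R * (i %/ lam)%:R <= i%:R :> rat by rewrite -natrM ler_nat.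
    by rewrite natrM; lra.
  have bm : zq (Cert.big (Z.of_nat A0) (Z.of_nat (i %/ lam))) / lam%:R <=
      zq (Cert.m (Z.of_nat A0) (Z.of_nat (i %/ lam))) / lam%:R.
    apply: ler_wpM2r; first by rewrite invr_ge0 ltW.
    by rewrite zq_le /Cert.m; clear; case: ifP => _; lia.
  have := le_trans le bm; rewrite mulrC -(ler_pdivlMr _ _ S0) => /le_trans; apply.
  by apply: eq_ler; rewrite /f mulrAC.
have B : crowd_sum j h (fun i => f (i %/ lam)%N / lam%:R) * Sq <=
    zq (Cert.msum (Z.of_nat A0) (Z.of_nat j0) (2 ^ (6 + r) + 1)).
  rewrite zq_msum.
  have -> : (2 ^ (6 + r) + 1 = (2 * A0).+1)%N by rewrite addn1 /A0 -expnS.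
  rewrite /crowd_sum -mulr_suml.
  apply: le_trans (_ : _ <= (lam%:R * \sum_(j0 <= i < j0 + (2 * A0).+1) f i) / lam%:R * Sq) _.
    apply: ler_wpM2r; first exact: ltW.
    apply: ler_wpM2r; first by rewrite invr_ge0 ltW.
    rewrite -sum_blocks //; apply: (@sum_subrange _ (fun i => f (i %/ lam)%N)) => [i| |]; [exact: f0| |exact: cr].
    by apply: leq_trans (leqnSn _); case/andP: hl.
  apply: eq_ler; rewrite mulrAC [_ * _ / _]mulrAC -mulr_suml; field.
  by rewrite gt_eqF // gt_eqF.
have e := elow_le hr hj l0 hl hH h0; rewrite (ler_pdivrMr _ _ S0) in e.
have ok := block_ok hr hj; rewrite /Block.ok in ok.
rewrite /request_ok -/F.
have z2 : zq 2%zz = 2 by exact: (zqS (erefl : 2%zz = Z.of_nat 2)).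
have inr : (h < 5)%N = false by clear -hF F7; lia.
have inr2 : inrange h j = true.
  apply/and4P; split; [lia | lia | |].
    by apply: leq_trans pF; rewrite leq_exp2l //; clear -hF; lia.
  by apply: leq_trans jF _; rewrite leq_exp2l //; case/andP: hF.
have Z1 : zq (147500)%zz * 400 = Sq * 59.
  have := etrans (esym (zqM 147500%zz 400%zz)) (zqM Cert.S 59%zz : zq (147500 * 400)%zz = _).
  by rewrite (zqS (erefl : 400%zz = Z.of_nat 400)) (zqS (erefl : 59%zz = Z.of_nat 59)).
have Z2 : zq (880000)%zz * 25 = Sq * 22.
  have := etrans (esym (zqM 880000%zz 25%zz)) (zqM Cert.S 22%zz : zq (880000 * 25)%zz = _).
  by rewrite (zqS (erefl : 25%zz = Z.of_nat 25)) (zqS (erefl : 22%zz = Z.of_nat 22)).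
rewrite inr inr2.
have h6 : (5 < h)%N by clear -hF F7; lia.
have epsE : eps h = 22/25 by rewrite /eps leqNgt h6.
have hq : h%:R - F.+2%:R = r%:R - 2 :> rat.
  by have := congr1 (fun n => n%:R : rat) F2; rewrite /= !natrD; lra.
rewrite hq epsE.
have tk := tick_large N j128; have rf := refresh_le h.
have okq : zq ((Z.of_nat r - 2) * Cert.S + Cert.msum (2 ^ Z.of_nat (5 + r)) (Z.of_nat j0) (2 ^ (6 + r) + 1)
   - Block.elow r (Z.of_nat j0) + 147500)%zz <= zq 880000%zz by rewrite zq_le.
have AE : (2 ^ Z.of_nat (5 + r) = Z.of_nat A0)%zz by rewrite /A0; clear; lia.
rewrite AE zqD zqB zqD zqM zqB zq_nat z2 -/Sq in okq.
move: (crowd_sum _ _ _) B => B hB; move: (env j 0 h) e => E' e.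
rewrite -(ler_pM2r S0).
have tS : tick N j * Sq <= 11/200 * Sq by apply: ler_wpM2r => //; exact: ltW.
have rS : refresh h * Sq <= 37/400 * Sq by apply: ler_wpM2r => //; exact: ltW.
lra.
Qed.

Theorem request_certified N j h : (0 < h <= j)%N -> certified N j h.
Proof.
move=> /andP[h0 hj]; have [j16|j16] := ltnP j 16.
  by apply: small_certified; rewrite ?h0 ?j16 //; lia.
have [hF|hF] := leqP (trunc_log 2 j + 4) h; first exact: certified_high.
have [j128|j128] := ltnP j 128.
  by apply: small_certified; rewrite ?h0 //; apply/orP; right; lia.
have [hF'|hF'] := leqP h (trunc_log 2 j); first by apply: certified_low; rewrite ?h0.
by apply: certified_mid; lia.
Qed.

(** * The amortized inequality *)

Lemma card_inj_bound (T : finType) (B : {set T}) (t : T -> nat) j M :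
  {in B &, injective t} -> {in B, forall x, (j < t x <= M)%N} -> (#|B| <= M - j)%N.
Proof.
move=> tinj tr; rewrite -[X in (_ <= X)%N](size_iota j.+1) cardE -(size_map t).
apply: uniq_leq_size.
  by rewrite map_inj_in_uniq ?enum_uniq // => x y; rewrite !mem_enum; apply: tinj.
by move=> _ /mapP[x + ->]; rewrite mem_enum mem_iota => /tr; lia.
Qed.

(** [m] need not be monotone: [r x] lies below [m i] for every admissible [i] up to the rank of [x].
    Among [n.+1] distinct ranks above [j] the largest is at least [j + n.+1], so its node can be
    charged to the last term. *)
Lemma sum_by_rank (T : finType) (B : {set T}) (t : T -> nat) (r : T -> rat) (m : nat -> rat) j n :
  {in B &, injective t} -> {in B, forall x, (j < t x)%N} -> (#|B| <= n)%N -> (forall i, 0 <= m i) ->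
  {in B, forall x i, (j < i <= j + n)%N -> (i <= t x)%N -> r x <= m i} ->
  \sum_(x in B) r x <= \sum_(j.+1 <= i < (j + n).+1) m i.
Proof.
elim: n B => [|n IH] B tinj tj cB m0 rm.
  have -> : B = set0 by apply/eqP; rewrite -cards_eq0; lia.
  by rewrite big_set0 addn0 (big_geq (leqnn _)) lexx.
have [cn|cn] := leqP #|B| n.
  apply: le_trans (IH B tinj tj cn m0 _) _.
    by move=> x xB i ji it; apply: rm => //; lia.
  by rewrite addnS [leRHS]big_nat_recr ?lerDl //=; lia.
have [x0 x0B] : exists x0, x0 \in B by apply/card_gt0P; lia.
have [x xB xmax] := @arg_maxnP _ x0 (mem B) t x0B; change (is_true (x \in B)) in xB.
have tx : (j + n.+1 <= t x)%N.
  have : (#|B| <= t x - j)%N.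
    by apply: card_inj_bound tinj _ => y yB; rewrite tj //=; exact: xmax.
  by have := tj x xB; lia.
rewrite (big_setD1 x xB) /= addnS big_nat_recr /=; last by lia.
rewrite addrC; apply: lerD; last by rewrite -addnS; apply: rm => //; lia.
apply: IH => //.
- by move=> y z /setD1P[_ yB] /setD1P[_ zB]; apply: tinj.
- by move=> y /setD1P[_ yB]; apply: tj.
- by have := cardsD1 x B; rewrite xB; lia.
- by move=> y /setD1P[_ yB] i ji it; apply: rm => //; lia.
Qed.

(** * Potential of a single node *)

Section Potential.
Variables (V : finType).
Implicit Types (L suf : seq V) (x v : V).

Definition psi L suf x k : rat :=
  let J := next_rank L suf x in
  if (x \in L) && (x \in suf) then env J (J - rank L x) k else 0.

(** The truncated subtraction leaves no charge on nodes more than [2 ^ (l - 2)] ticks away. *)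
Definition omg L suf x l : rat :=
  if awaited l L suf x then weight l * ((2 ^ (l - 2)).+1 - tau l L suf x)%N%:R else 0.

Lemma omg_avg L suf k (B : {set V}) :
  \sum_(x in B) omg L suf x k.+2 <= 2 ^+ k * eps k.+2.
Proof.
rewrite /omg -big_mkcondr /= -mulr_sumr -natr_sum.
rewrite (eq_bigl [in [set x in B | awaited k.+2 L suf x]]); last by move=> x; rewrite inE.
rewrite /weight subn2 /= -natrX -natr1; set Q := (2 ^ k)%N.
set S := \sum_(_ in _) _.
have : (2 * S <= Q * Q.+1)%N.
  apply: sum_sub_inj => [x|x y]; rewrite !inE => /andP[_ ax]; first exact: tau_gt0.
  by move=> /andP[_ ay]; apply: tau_inj ax ay.
rewrite -(ler_nat rat) !natrM -[Q.+1%:R]natr1.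
have Q0 : 0 <= Q%:R :> rat by rewrite ler0n.
have := eps_ge k.+2; move: (eps _) (Q%:R) (S%:R) Q0 => e q s q0 e0 le.
have q1 : 0 < q + 1 by lra.
rewrite [leLHS]mulrAC (ler_pdivrMr _ _ q1).
have : 0 <= e * (q * (q + 1) - 2 * s) by apply: mulr_ge0; lra.
lra.
Qed.

(** The first inequality serves nodes that may be displaced by this request, the second those whose
    height cannot change. *)
Lemma psi_rankup L v suf x k : x != v -> (rank L x <= rank L v)%N -> (0 < k)%N ->
  psi (v :: rem v L) suf x k + (2 ^+ k.-1)^-1 * (psi (v :: rem v L) suf x k.+1 - psi (v :: rem v L) suf x k)
    <= psi L (v :: suf) x k
  /\ psi (v :: rem v L) suf x k <= psi L (v :: suf) x k.
Proof.
move=> xv rk k0; rewrite /psi mem_step // inE (negbTE xv) /= [v == x]eq_sym (negbTE xv) /=.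
case: ifP => [/andP[xL xs]|_]; last by rewrite !(subrr, mulr0, addr0) lexx.
have := rank_le_next (v :: rem v L) xs; rewrite rank_step // ltnNge rk /=.
set J := next_rank _ _ _ => J1.
have -> : (J - rank L x = (J - (rank L x).+1).+1)%N by lia.
have J0 : (0 < J)%N by lia.
by split; [apply: env_drift | apply: env_succ].
Qed.

Lemma psi_ranksame L v suf x k : x != v -> (rank L v < rank L x)%N ->
  psi (v :: rem v L) suf x k = psi L (v :: suf) x k.
Proof.
move=> xv rk; rewrite /psi mem_step // inE (negbTE xv) /= [v == x]eq_sym (negbTE xv) /=.
by rewrite rank_step // rk.
Qed.

Lemma psi_fresh L v suf : psi (v :: rem v L) suf v 1 <= 0.
Proof.
rewrite /psi; case: ifP => [/andP[_ vs]|_]; last exact: lexx.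
have r1 : rank (v :: rem v L) v = 1%N by rewrite /rank /= eqxx.
have := rank_le_next (v :: rem v L) vs; rewrite r1; move: (next_rank _ _ _) => J J0.
by rewrite subn1; exact: (env_start J0).
Qed.

Lemma omg_step L v suf x l : x != v ->
  omg (v :: rem v L) suf x l <=
  omg L (v :: suf) x l + if (v \in L) && inrange l (rank L v) then weight l else 0.
Proof.
move=> xv; rewrite /omg awaited_step // /= eq_sym (negbTE xv).
have w0 := weight_ge0 l.
have i0 : 0 <= (if (v \in L) && inrange l (rank L v) then weight l else 0) by case: ifP.
case: ifP => _; last by rewrite add0r.
set t := tau _ _ _ _; case: ((v \in L) && inrange l (rank L v)) => /=; last by rewrite addr0 lexx.
rewrite -[X in _ <= _ + X]mulr1 -mulrDr; apply: ler_wpM2l => //.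
by rewrite natr1 ler_nat; lia.
Qed.
End Potential.



(** * Height invariant and level counts *)

Section Step.
Variables (N : nat) (V : finType) (u : V) (a : N.-tuple bool).
Hypothesis cardV : #|V| = (2 ^ N)%N.

Definition Phi L suf (c : state N V) : rat := \sum_x pot a (psi L suf) (omg L suf) x (c x).

Record invariant (L : seq V) (c : state N V) : Prop := Invariant {
  inv_inj : injective c;
  inv_u : c u = a;
  inv_fresh : u \notin L;
  inv_uniq : uniq L;
  inv_height : {in L, forall x, (height a (c x) <= rank L x)%N} }.

(** If [x] ranks above [v] its rank stays, and it rises only from a height below that of [v], which
    is at most [rank L v < rank L x]. Otherwise its rank grows by one, and its height by at most
    one. *)
Lemma invariant_step L v c c' : v != u -> invariant L c -> after u a v c c' ->
  invariant (v :: rem v L) c'.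
Proof.
clear cardV; move=> vu [inj cu uL uq hL] [inj' cu' hv hx]; split => //.
- by rewrite mem_step // eq_sym.
- exact: uniq_step.
move=> x; have [->|xv] := eqVneq x v; first by rewrite hv.
rewrite mem_step // => xL; have := hx x xv; have := hL x xL; rewrite rank_step //.
case: (ltnP (rank L v) (rank L x)) => [lt|_]; last by case: (_ < _)%N; lia.
have vL : v \in L by rewrite -index_mem; move: lt; rewrite ltnS => /leq_trans; apply; exact: index_size.
by have := hL v vL; case: ltnP; lia.
Qed.

Variables (L : seq V) (v : V) (suf : seq V) (c : state N V).
Hypotheses (vu : v != u) (inv : invariant L c).
Let h := height a (c v).
Let j := rank L v.
Let psi' := psi (v :: rem v L) suf.
Let omg' := omg (v :: rem v L) suf.

Lemma height_gt0 x : x != u -> (0 < height a (c x))%N.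
Proof.
case: inv => inj cu _ _ _ xu; rewrite lt0n height0 -cu.
by apply: contra xu => /eqP /inj ->.
Qed.

Lemma sum_levels (D : V -> nat -> rat) k : (k < h)%N ->
  \sum_(1 <= l < k.+1) (2 ^+ l.-1)^-1 * \sum_(x in level a c l) D x l =
  \sum_(x | x != v) if (0 < height a (c x) <= k)%N
     then (2 ^+ (height a (c x)).-1)^-1 * D x (height a (c x)) else 0.
Proof.
clear cardV vu inv psi' omg' j L suf; move=> kh; rewrite big_add1 /= big_mkord.
rewrite (eq_bigr (fun l : 'I_k => \sum_(x | (height a (c x) == l.+1)) (2 ^+ (height a (c x)).-1)^-1 * D x (height a (c x)))); last first.
  move=> l _; rewrite mulr_sumr; apply: eq_big => x; first by rewrite inE.
  by rewrite inE => /eqP ->.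
rewrite -big_mkcondr /= [LHS](exchange_big_dep (fun x => (x != v) && (0 < height a (c x) <= k)%N)) /=; last first.
  move=> l x _ /eqP e; rewrite e /= ltn_ord andbT.
  by apply/eqP => xv; move: e kh; rewrite xv -/h => ->; have := ltn_ord l; lia.
apply: eq_bigr => x /and3P[_ h0 hk].
have hk' : ((height a (c x)).-1 < k)%N by lia.
rewrite (big_pred1 (Ordinal hk')) // => l /=.
by rewrite -val_eqE /=; apply/eqP/eqP; lia.
Qed.

Lemma sum_antipodal (g : nat -> rat) : (forall l, 0 <= g l) ->
  \sum_(x | (5 <= height a (c x))%N && antipodal a (c x)) g (height a (c x)) <= \sum_(5 <= l < N.+1) g l.
Proof.
move=> g0; have inj := inv_inj inv.
have lt x : (height a (c x) < N.+1)%N by rewrite ltnS height_le.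
rewrite (partition_big (fun x => Ordinal (lt x)) (fun l : 'I_N.+1 => (5 <= l)%N)) /=; last by move=> x /andP[].
have -> : \sum_(5 <= l < N.+1) g l = \sum_(l < N.+1 | (5 <= l)%N) g l.
  by rewrite big_geq_mkord.
apply: ler_sum => l l5.
have [x0 /andP[/andP[_ b0] /eqP e0]|none] := pickP [pred x | ((5 <= height a (c x))%N && antipodal a (c x)) && (Ordinal (lt x) == l)].
  have h0 : height a (c x0) = l by rewrite -e0.
  rewrite (big_pred1 x0) ?h0 // => x /=; apply/andP/eqP => [[/andP[_ b] /eqP e]|->].
    by apply: inj; apply: (antipodal_inj (a := a)) => //; rewrite h0 -e.
  by split; [rewrite b0 andbT h0; exact: l5 | exact/eqP].
by rewrite big_pred0 // => x; apply: none.
Qed.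

(** [B] and the first [h.-1] nodes in recency order are disjoint, and with the server removed both
    lie among the [2 ^ h.-1] nodes of height below [h]; for the recent ones because height is at
    most rank. *)
Lemma card_b_type (B : {set V}) : v \in L ->
  {in B, forall x, [&& x \in L, (j < rank L x)%N & (0 < height a (c x) < h)%N]} ->
  (#|B| <= crowd j h)%N.
Proof.
case: inv => inj cu uL uq hL vL hB.
have hj : (h <= j)%N by apply: hL.
have h0 : (0 < h)%N := height_gt0 vu.
pose C := [set x in take h.-1 L].
have jL : (j <= size L)%N by rewrite /j /rank index_mem.
have cC : #|C| = h.-1.
  rewrite cardsE -[RHS](_ : size (take h.-1 L) = _); last by rewrite size_takel //; lia.
  by apply/card_uniqP; exact: take_uniq.
have rC x : x \in C -> (x \in L) && (rank L x <= h.-1)%N.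
  rewrite inE => xt; rewrite (mem_take xt) /= /rank.
  have -> : index x L = index x (take h.-1 L) by rewrite -{1}(cat_take_drop h.-1 L) index_cat xt.
  apply: leq_trans (_ : _ <= size (take h.-1 L))%N _; first by rewrite index_mem.
  by rewrite size_take_min geq_minl.
have dis : [disjoint B & C].
  rewrite disjoint_subset; apply/subsetP => x /hB /and3P[_ lt _]; rewrite inE.
  by apply/negP => /rC /andP[_]; lia.
have hN : (h.-1 <= N)%N by have := height_le a (c v); rewrite -/h; lia.
have [g _ gK] := coord_bij cardV inj.
have sub : B :|: C \subset [set x | (height a (c x) <= h.-1)%N] :\ u.
  apply/subsetP => x /setUP[/hB /and3P[xL _ /andP[_ lt]]|/rC /andP[xL le]]; rewrite !inE.
    by apply/andP; split; [apply: contraNneq uL => <- | lia].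
  by apply/andP; split; [apply: contraNneq uL => <- | apply: leq_trans (hL x xL) le].
have cH : #|[set x | (height a (c x) <= h.-1)%N]| = (2 ^ h.-1)%N.
  rewrite -(card_height_le a hN) -[LHS](card_imset _ inj); apply: eq_card => t; rewrite inE.
  apply/imsetP/idP => [[x]|le]; first by rewrite inE => le ->.
  by exists (g t); rewrite ?inE gK.
have uH : u \in [set x | (height a (c x) <= h.-1)%N].
  by rewrite inE cu; have := height0 a a; rewrite eqxx => /eqP ->.
have := subset_leq_card sub; have := cardsD1 u [set x | (height a (c x) <= h.-1)%N].
rewrite uH cH cardsU disjoint_setI0 // cards0 subn0 cC /crowd; lia.
Qed.
End Step.


(** * Amortized cost of one request *)

Section Request.
Variables (N : nat) (V : finType) (u : V) (a : N.-tuple bool).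
Hypothesis cardV : #|V| = (2 ^ N)%N.
Variables (L : seq V) (v : V) (suf : seq V) (c : state N V).
Hypotheses (vu : v != u) (inv : invariant u a L c).
Local Notation h := (height a (c v)).
Local Notation j := (rank L v).
Local Notation ht x := (height a (c x)).
Local Notation psi' := (psi (v :: rem v L) suf).
Local Notation omg' := (omg (v :: rem v L) suf).

Lemma mem_below x : x \in L -> (j < rank L x)%N -> v \in L.
Proof.
move=> xL; rewrite -[v \in L]index_mem ltnS => /leq_trans; apply; exact: index_size.
Qed.

(** Their rank is unaffected by the request, so no drop in [s] offsets a possible rise in height. *)
Definition hurt : {set V} := [set x | [&& x \in L, (j < rank L x)%N & (0 < ht x < h)%N]].

Definition gain x : rat :=
  let J := next_rank L (v :: suf) x in
  if x \in suf then Num.max 0 (rise J (J - rank L x)%N%:R (2 ^+ (ht x).-1)) else 0.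

Lemma psi_change x : x != v ->
  psi' x (ht x) + (if (0 < ht x <= h.-1)%N
     then (2 ^+ (ht x).-1)^-1 * (psi' x (ht x).+1 - psi' x (ht x)) else 0)
  <= psi L (v :: suf) x (ht x) + (if x \in hurt then gain x else 0).
Proof.
move=> xv; have h0 : (0 < h)%N := height_gt0 inv vu.
have [xL|xL] := boolP (x \in L); last first.
  have z k : psi' x k = 0 by rewrite /psi mem_step // (negbTE xL).
  have z2 k : psi L (v :: suf) x k = 0 by rewrite /psi (negbTE xL).
  have -> : (x \in hurt) = false by rewrite inE (negbTE xL).
  by rewrite !z z2 subrr mulr0 if_same !addr0 lexx.
have xu : x != u by apply: contraNneq (inv_fresh inv) => <-.
have x0 := height_gt0 inv xu.
have [le|lt] := leqP (rank L x) j.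
  have [p1 p2] := psi_rankup suf xv le x0.
  have -> : (x \in hurt) = false by rewrite inE ltnNge le andbF.
  by rewrite addr0; case: ifP; rewrite ?addr0.
rewrite !psi_ranksame // x0 /= inE xL lt x0 /=.
have -> : (ht x <= h.-1)%N = (ht x < h)%N by lia.
rewrite lerD2l; case: ifP => _; last exact: lexx.
rewrite /psi xL inE (negbTE xv) /= /gain.
case: ifP => xs; last by rewrite subrr mulr0 lexx.
apply: env_rise => //.
by apply: leq_trans (rank_le_next L (_ : x \in v :: suf)); rewrite ?inE ?xs ?orbT.
Qed.

Lemma gain_sum m : (v \in L -> majorant j h m) ->
  \sum_(x in hurt) gain x <= if v \in L then crowd_sum j h m else 0.
Proof.
move=> mj; case: ifP => vL; last first.
  rewrite big1 ?lexx // => x; rewrite inE => /and3P[xL lt _].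
  by rewrite (mem_below xL lt) in vL.
have [m0 mr] := mj vL; apply: (@sum_by_rank V hurt (rank L) gain m j (crowd j h) _ _ _ m0).
- move=> x y; rewrite !inE => /andP[xL _] /andP[yL _] [e].
  by rewrite -(nth_index x xL) e nth_index.
- by move=> x; rewrite inE => /and3P[].
- apply: (card_b_type cardV vu inv vL) => x; rewrite inE => /and3P[-> -> ->] //.
move=> x; rewrite inE => /and3P[xL lt /andP[x0 xh]] i ji ix.
rewrite /gain; case: ifP => xs; last exact: m0.
have xs' : x \in v :: suf by rewrite inE xs orbT.
have rJ := rank_le_next L xs'; set J := next_rank _ _ _ in rJ *.
rewrite ge_max m0 /=; apply: le_trans (mr i J ji (leq_trans ix rJ)).
apply: le_trans (rise_mono _ _ (_ : _ <= 2 ^+ (h - 2))) _.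
  by rewrite ler_eXn2l ?ltr1n //; lia.
rewrite /rise; apply: ler_wpM2r; first by rewrite invr_ge0 exprn_ge0 // ler0n.
rewrite lerD2r; apply: ler_wpM2l; first by apply: ltW; exact: kap_gt0.
have : (J - rank L x)%N%:R <= J%:R - i%:R :> rat.
  by rewrite natrB // lerD2l lerN2 ler_nat.
lra.
Qed.

Lemma psi_part m : (v \in L -> majorant j h m) ->
  \sum_(x | x != v) psi' x (ht x) +
  \sum_(1 <= l < h.-1.+1) (2 ^+ l.-1)^-1 * \sum_(x in level a c l) (psi' x l.+1 - psi' x l)
  <= \sum_(x | x != v) psi L (v :: suf) x (ht x) + if v \in L then crowd_sum j h m else 0.
Proof.
move=> mj; have h0 : (0 < h)%N := height_gt0 inv vu.
have hh : (h.-1 < h)%N by rewrite ltn_predL.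
rewrite (sum_levels (fun x l => psi' x l.+1 - psi' x l) hh).
rewrite -big_split /=; apply: le_trans (ler_sum _ psi_change) _.
rewrite big_split /= lerD2l; apply: le_trans (gain_sum mj).
rewrite -big_mkcondr /= le_eqVlt; apply/orP; left; apply/eqP; apply: eq_bigl => x.
by apply: andb_idl; rewrite inE => /and3P[_ lt _]; apply: contraTneq lt => ->; rewrite ltnn.
Qed.

Local Notation bad x := ((5 <= ht x)%N && antipodal a (c x)).
Local Notation toll l := (if (v \in L) && inrange l j then weight l else 0).

Lemma toll_sum : \sum_(5 <= l < N.+1) toll l = if v \in L then tick N j else 0.
Proof.
case: ifP => vL; last by rewrite big1.
by rewrite /tick [RHS]big_mkcond.
Qed.

(** Each level has at most one antipodal node, whose charge grows by at most [weight] per tick. If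
    [v] itself is antipodal, the share of its level is unspent, hence [toll h] on the left. *)
Lemma omg_part :
  \sum_(x | x != v) (if bad x then omg' x (ht x) else 0) + (if bad v then toll h else 0)
  <= \sum_(x | x != v) (if bad x then omg L (v :: suf) x (ht x) else 0) + if v \in L then tick N j else 0.
Proof.
have t0 l : 0 <= toll l by case: ifP => _; [exact: weight_ge0 | exact: lexx].
rewrite -toll_sum; apply: le_trans (lerD (lexx _) (sum_antipodal inv t0)).
rewrite [X in _ <= _ + X]big_mkcond [X in _ <= _ + X](bigD1 v) //= [X in _ <= _ + X]addrC addrA lerD2r -big_split /=.
apply: ler_sum => x xv; case: ifP => _; last by rewrite addr0 lexx.
exact: omg_step.
Qed.

Lemma PhiE suf' L' : Phi a L' suf' c =
  psi L' suf' v h + (if bad v then omg L' suf' v h else 0) +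
  \sum_(x | x != v) psi L' suf' x (ht x) + \sum_(x | x != v) (if bad x then omg L' suf' x (ht x) else 0).
Proof. by rewrite /Phi (bigD1 v) //= /pot big_split /= addrA. Qed.

Lemma psi_served : psi L (v :: suf) v h = if v \in L then env j 0 h else 0.
Proof. by rewrite /psi /= inE eqxx /= andbT subnn. Qed.

Lemma omg_served l : omg L (v :: suf) v l =
  if (v \in L) && inrange l j then weight l * (2 ^+ (l - 2)) else 0.
Proof.
rewrite /omg /awaited /= inE !eqxx /=; case: ifP => [/andP[vL i]|//].
by rewrite vL i /= addn0 subn1 /= natrX.
Qed.

Lemma weight_full l : weight l * 2 ^+ (l - 2) + weight l = 2 * eps l.
Proof. by rewrite /weight; have := pow2_gt0 (l - 2); move: (2 ^+ _) => q q0; field; lra. Qed.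

Lemma dist_height : (dist c u v)%:R + (~~ antipodal a (c v))%:R <= h%:R :> rat.
Proof.
rewrite -natrD ler_nat; apply: leq_trans (hamming_height a (c v)).
by rewrite leq_add2r -(inv_u inv); apply: dist_le_hamming => //; exact: inv_inj inv.
Qed.

Lemma refresh_small : (h < 5)%N -> refresh h = 0.
Proof. by move=> h5; rewrite /refresh big_nat_cond big1 // => l; lia. Qed.

Lemma bound_split :
  bound a psi' omg' eps v h.-1 c =
  \sum_(x | x != v) psi' x (ht x) +
  \sum_(1 <= l < h.-1.+1) (2 ^+ l.-1)^-1 * \sum_(x in level a c l) (psi' x l.+1 - psi' x l) +
  \sum_(x | x != v) (if bad x then omg' x (ht x) else 0) + psi' v 1 +
  (if bad v then eps h else 0) + refresh h.
Proof.
have h0 : (0 < h)%N := height_gt0 inv vu.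
have ac (x y p q s r : rat) : x + y + p + q + s + r = x + q + y + p + s + r by ring.
by rewrite /bound /pot big_split /= /refresh prednK // ac.
Qed.

(** Of the 2 added to [trunc_log 2 j], one comes from [WS_repeat] and one is the per-request share
    of [m]. *)
Lemma request_repeat : v \in L ->
  (dist c u v)%:R + bound a psi' omg' eps v h.-1 c <= (trunc_log 2 j).+2%:R + Phi a L (v :: suf) c.
Proof.
move=> vL; have h0 : (0 < h)%N := height_gt0 inv vu.
have hj : (0 < h <= j)%N by rewrite h0; exact: inv_height inv v vL.
have [m [mj ok]] := request_certified N hj.
have P := psi_part (fun _ => mj); have O := omg_part; have F := psi_fresh L v suf.
have dh := dist_height; have W := weight_full h.
rewrite PhiE psi_served omg_served bound_split.
rewrite vL /= in P O *; move: ok; rewrite /request_ok.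
have rs := refresh_small; have el := eps_le h; have eg := eps_ge h.
move: P O F dh W rs el eg.
move: (\sum_(_ | _) _) (\sum_(_ <= _ < _) _) (\sum_(_ | _) _) (\sum_(_ | _) _) (\sum_(_ | _) _) => S1 S2 S3 S4 S5.
move: (weight h) (2 ^+ (h - 2)) (psi' v 1) (env j 0 h) (refresh h) (eps h) (tick N j) (crowd_sum j h m)
  ((dist c u v)%:R) ((trunc_log 2 j).+2%:R) => w q p e r ep t b d f.
case: (ltnP h 5) => h5 /=; case: (antipodal a (c v)) => /=; case: (inrange h j) => /= P O F' dh W rs el eg ok;
  rewrite ?(rs isT); lra.
Qed.

(** A fresh [v] ranks above all of [L], so nobody is hurt. The extra 1 covers [eps h + refresh h],
    at most [389/400]. *)
Lemma request_fresh : v \notin L ->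
  (dist c u v)%:R + bound a psi' omg' eps v h.-1 c <= h%:R + 1 + Phi a L (v :: suf) c.
Proof.
move=> vL; have P := @psi_part (fun=> 0); have O := omg_part; have F := psi_fresh L v suf.
rewrite (negbTE vL) /= in P O; move: (P ltac:(by [])) => {}P.
have dh := dist_height; rewrite PhiE psi_served omg_served bound_split (negbTE vL) /=.
have rs := refresh_le h; have el := eps_le h; have eg := eps_ge h.
move: P O F dh rs el eg.
move: (\sum_(_ | _) _) (\sum_(_ <= _ < _) _) (\sum_(_ | _) _) (\sum_(_ | _) _) (\sum_(_ | _) _) => S1 S2 S3 S4 S5.
move: (psi' v 1) (refresh h) (eps h) ((dist c u v)%:R) => p r ep d.
rewrite !if_same.
case: (5 <= h)%N => /=; case: (antipodal a (c v)) => /= P O F' dh rs el eg; lra.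
Qed.
End Request.

(** * Induction over the request sequence *)

Section Run.
Variables (N : nat) (V : finType) (u : V) (a : N.-tuple bool).
Hypothesis cardV : #|V| = (2 ^ N)%N.
Variable vs : seq V.
Hypothesis uvs : u \notin vs.
Local Notation s := [seq (u, x) | x <- vs].
Local Notation rq t := (req s (u, u) t).
Local Notation cost := (fun t (c : state N V) => (dist c (rq t).1 (rq t).2)%:R%R : rat).
Local Notation ws := (fun t (c : state N V) => (up_log 2 (WSnum s c t (rq t).1 (rq t).2))%:R%R : rat).

Lemma swapsE_addc v ds (G : state N V -> rat) b c : 0 <= b ->
  swapsE u v ds (fun c' => G c' + b) c <= swapsE u v ds G c + b.
Proof.
move=> b0; elim: ds c => [|d ds IH] c /=; first exact: lexx.
set B := csubtree c u d.
apply: le_trans (_ : _ <= #|B|%:R^-1 * \sum_(r in B) (swapsE u v ds G (swapc c v r) + b)) _.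
  by apply: ler_wpM2l; [rewrite invr_ge0 ler0n | apply: ler_sum => r _; exact: IH].
rewrite big_split /= mulrDr lerD2l sumr_const -[b *+ _]mulr_natr mulrCA.
(* Over an empty set the average is 0, the inverse of 0 being 0; nonnegativity of [b] then gives the
   inequality. *)
have [->|c0] := eqVneq (#|B|%:R : rat) 0; first by rewrite invr0 mul0r mulr0.
by rewrite mulVf // mulr1 lexx.
Qed.

Lemma omg_ge0 (L suf : seq V) x l : 0 <= omg L suf x l.
Proof. by rewrite /omg; case: ifP => _; [apply: mulr_ge0; [exact: weight_ge0 | exact: ler0n] | exact: lexx]. Qed.

Lemma run_bound suf pre c : vs = pre ++ suf -> invariant u a (mru pre) c ->
  runE [seq (u, x) | x <- suf] cost (size pre).+1 c <=
  runE [seq (u, x) | x <- suf] ws (size pre).+1 c + (size suf)%:R + Phi a (mru pre) suf c.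
Proof.
elim: suf pre c => [|v suf IH] pre c E inv.
  (* A node with no future request carries no potential. *)
  rewrite /= /Phi big1 ?addr0 ?lexx // => x _.
  by rewrite /pot /psi /omg /awaited /= !andbF if_same addr0.
have vu : v != u by apply: contraNneq uvs => <-; rewrite E mem_cat inE eqxx orbT.
have uF : u \notin pre by apply: contra uvs; rewrite E mem_cat => ->.
have rE : rq (size pre).+1 = (u, v).
  by rewrite /req /= (nth_map u) E ?nth_cat ?ltnn ?subnn // size_cat /= addnS ltnS leq_addr.
rewrite /= rE /=.
have h0 := height_gt0 inv vu; have cu := inv_u inv; have hN := height_le a (c v).
set h := height a (c v) in h0 hN.
have al : lcp (c u) (c v) = (N - h)%N by rewrite cu /h /height subKn // lcp_tuple.
have kN : (h.-1 < N)%N by clear -h0 hN; lia.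
rewrite /stepE al.
(* Prefix length [alpha + 2] corresponds to height [h - 1]: the swaps run through the heights
   [h - 1] down to 1. *)
have -> : (N - h).+2 = (N - h.-1).+1 by clear -h0 hN; lia.
have -> : (N - (N - h).+1 = h.-1)%N by clear -h0 hN; lia.
have uv : u != v by rewrite eq_sym.
have step c' : after u a v c c' ->
  runE [seq (u, x) | x <- suf] cost (size pre).+2 c' <=
  (runE [seq (u, x) | x <- suf] ws (size pre).+2 c' + (size suf)%:R) +
   \sum_x pot a (psi (v :: rem v (mru pre)) suf) (omg (v :: rem v (mru pre)) suf) x (c' x).
  move=> af; have := IH (rcons pre v) c'; rewrite cat_rcons mru_rcons size_rcons; apply => //.
  exact: invariant_step vu inv af.
have e0 l : 0 <= eps l by have := eps_ge l; lra.
have hv : height a (c v) = h.-1.+1 by rewrite prednK.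
have := swapsE_bound cardV (omg_ge0 (v :: rem v (mru pre)) suf) e0
  (fun k B _ => omg_avg (v :: rem v (mru pre)) suf k B) uv kN cu (inv_inj inv) hv step.
move=> /le_trans /(_ (lerD (swapsE_addc _ _ _ _ (ler0n _ _)) (lexx _))) le.
have : (dist c u v)%:R + bound a (psi (v :: rem v (mru pre)) suf) (omg (v :: rem v (mru pre)) suf) eps v h.-1 c
  <= (up_log 2 (WSnum s c (size pre).+1 u v))%:R + 1 + Phi a (mru pre) (v :: suf) c.
  have [vp|vp] := boolP (v \in pre).
    have vL : v \in mru pre by rewrite mem_mru.
    apply: le_trans (request_repeat cardV suf vu inv vL) _.
    by rewrite lerD2r natr1 ler_nat ltnS E; apply: WS_repeat.
  have vL : v \notin mru pre by rewrite mem_mru.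
  apply: le_trans (request_fresh cardV suf vu inv vL) _.
  by rewrite lerD2r lerD2r ler_nat E -cu; apply: WS_fresh.
rewrite -[(size suf).+1%:R]natr1.
move: le; move: (swapsE _ _ _ _ _) (swapsE _ _ _ _ _) (bound _ _ _ _ _ _ _) (Phi _ _ _ _)
  ((dist c u v)%:R) ((up_log 2 _)%:R) ((size suf)%:R) => A B C D x y z.
lra.
Qed.
End Run.

Theorem mainTheorem4 (N : nat) (V : finType) (u : V) (c0 : state N V)
  (s : seq (V * V)) :
  #|V| = (2 ^ N)%N ->
  bijective c0 ->
  (forall p, p \in s -> p.1 = u /\ p.2 != u) ->
  (expected_cost u s c0 <= expected_WS u s c0 + (size s)%:R)%R.
Proof.
move=> cardV bij hs.
pose vs := unzip2 s.
have sE : s = [seq (u, x) | x <- vs].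
  rewrite /vs /unzip2 -map_comp -[LHS]map_id; apply/eq_in_map => -[p q] /hs /= [-> _].
  by [].
have uvs : u \notin vs by apply/negP => /mapP[p /hs [_ pu] e]; rewrite -e eqxx in pu.
have inv : invariant u (c0 u) (mru [::]) c0 by split=> //; exact: bij_inj.
have := run_bound cardV uvs (erefl _ : vs = [::] ++ vs) inv.
rewrite /= -sE /Phi big1; last first.
  (* Before the first request the recency list is empty, so the initial potential is 0 for every
     starting hypercube. *)
  by move=> x _; rewrite /pot /psi /omg /awaited /= if_same addr0.
by rewrite addr0 /vs size_map.
Qed.
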